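(* Let $K\subset S^3$ be an oriented knot with generic planar diagram $D_K$, and choose two adjacent faces of $D_K$ to disregard. Let $\Gamma=(V_1,V_2,E)$ be the associated Alexander graph, with the weighting $\alpha:E\to\mathbb C[t]$ given by the local weights at crossings, and let $\epsilon:E\to\{\pm1\}$ be a Kasteleyn weighting of $\Gamma$. Then $$\Delta_K(t)\ \doteq\ Z(\Gamma_{\epsilon\cdot\alpha})=\sum_{m\in\mathcal M}\ \prod_{e\in m}\epsilon(e)\,\alpha(e),$$ where $\mathcal M$ is the set of dimer coverings of $\Gamma$ and $\Delta_K(t)$ is the Alexander polynomial of $K$.
   Context: **Notation.** $\doteq$ means equality up to multiplication by $\pm t^k$, $k\in\mathbb Z$. A dimer covering of a bipartite graph (parallel edges allowed) is a perfect matching. For an edge weighting $\mu$, $Z(\Gamma_\mu)=\sum_{m}\prod_{e\in m}\mu(e)$, the sum being over all dimer coverings. **Kasteleyn weighting.** For a bipartite plane graph, a map $\epsilon:E\to\{\pm1\}$ such that each bounded face with $0$ mod $4$ edges has an odd number of $-1$'s and each bounded face with $2$ mod $4$ edges has an even number of $-1$'s. Edges of a face boundary are counted with multiplicity (an edge with the face on both sides counts twice); if the graph is disconnected, the condition is imposed on each connected component regarded as a plane graph by itself. **Corners at a crossing.** Faces are the connected components of the complement of the diagram in the plane; two faces are adjacent if they share an edge of the diagram. Rotate a crossing so that the overstrand runs from south-west to north-east (in the direction of its orientation). Its four corners are North, West (both to the left of the overstrand), East, South (both to the right). Let $a_1,a_2,a_3,a_4$ be the faces at the corners North, West, East, South respectively.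 **Alexander polynomial.** Let $a_0,\dots,a_m$ be the faces, $a_0$ unbounded. With base point above the plane, let $A_i\in\pi=\pi_1(S^3-K)$ be the loop going down through $a_i$ and returning up through $a_0$; so $A_0=1$. Each crossing gives a relation $A_4A_2^{-1}=A_3A_1^{-1}$ (indices as in the corner convention), i.e. the relator $r=A_4A_2^{-1}A_1A_3^{-1}$; after setting $A_0=1$ this gives the Dehn presentation $\pi=\langle A_1,\dots,A_m\mid r_1,\dots,r_{m-1}\rangle$, with one relator per crossing. Let $\mathcal F_m$ be the free group on $A_1,\dots,A_m$, $\phi:\mathbb Z[\mathcal F_m]\to\mathbb Z[\pi]$ the canonical map, and $\psi:\mathbb Z[\pi]\to\mathbb Z[t^{\pm1}]$ the abelianization sending positively linking meridians to $t$. Let $M_K$ be the $(m-1)\times m$ matrix with entries $\psi\circ\phi(\partial r_i/\partial A_j)$ (Fox free derivatives), and $M_K'$ the square matrix obtained by removing a column corresponding to a face adjacent to the unbounded face. Then $\Delta_K(t)\doteq\det(M_K')$, which up to $\doteq$ does not depend on the choices. **Alexander graph.** $V_1$ is the set of crossings of $D_K$; $V_2$ is the set of faces of $D_K$ other than the two disregarded ones; there is an edge between a crossing and a face for each corner at which the crossing is incident to the face. It is a plane graph: each face vertex is placed inside its face and each edge runs inside the face to the corresponding corner. **Local weights.** The edge of a crossing at its North or West corner (left of the overstrand) has $\alpha=t$; the edge at its East or South corner (right of the overstrand) has $\alpha=1$. *)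

(* Defs.v *)
From HB Require Import structures.
From mathcomp Require Import all_boot all_order all_algebra.

Set Implicit Arguments.
Unset Strict Implicit.
Unset Printing Implicit Defensive.

Import GRing.Theory.
Local Open Scope ring_scope.

(** * Oriented knot diagrams *)

(* A diagram with [n] crossings is a combinatorial map.  Rotate each crossing
   so that the overstrand runs from south-west to north-east.  Counterclockwise,
   the four half-edges at a crossing are 0 = NE (overstrand, outgoing), 1 = NW,
   2 = SW (overstrand, incoming), 3 = SE, and corner [k] lies between the
   half-edges [k] and [k + 1], so that the corners are 0 = North, 1 = West,
   2 = South, 3 = East.  The pair [(x, k)] stands both for the half-edge [k] and
   for the corner [k] of the crossing [x]: the corner [d] is on the left of the
   half-edge [d] directed away from its crossing, and the corner [cw d] is on
   its right. *)
Definition dart (n : nat) : finType := ('I_n * 'I_4)%type.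

Definition ccw n (d : dart n) : dart n := (d.1, d.2 + 1).
Definition cw n (d : dart n) : dart n := (d.1, d.2 - 1).
Definition across n (d : dart n) : dart n := (d.1, d.2 + 2%:R).

Definition north n (x : 'I_n) : dart n := (x, 0).
Definition west n (x : 'I_n) : dart n := (x, 1).
Definition south n (x : 'I_n) : dart n := (x, 2%:R).
Definition east n (x : 'I_n) : dart n := (x, 3%:R).

(* [under_nw x] says that the understrand of [x] leaves towards the north-west
   (a positive crossing); otherwise it leaves towards the south-east. *)
Definition outgoing n (under_nw : 'I_n -> bool) (d : dart n) : bool :=
  [|| d.2 == 0, (d.2 == 1) && under_nw d.1 | (d.2 == 3%:R) && ~~ under_nw d.1].

(* - [mate] exchanges the two half-edges of each edge of the diagram.
   - The orbits of [cw \o mate] on corners are the boundary walks of the faces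
     (with the face on the left); the faces carry the labels [0, ..., m] with
     [m = n + 1], and the label [0] is the unbounded face.  That there are
     exactly [n + 2] of them is planarity: [n - 2 n + (n + 2) = 2].
   - [across \o mate] follows the oriented knot from one edge to the next.
   The crossingless circle is the case [n = 0]; it has two faces and no corner,
   hence the hypothesis in [face_of_onto]. *)
Record knot_diagram := KnotDiagram {
  ncross : nat;
  mate : dart ncross -> dart ncross;
  under_nw : 'I_ncross -> bool;
  face_of : dart ncross -> 'I_ncross.+2;
  mateK : involutive mate;
  outgoing_mate : forall d, outgoing under_nw (mate d) = ~~ outgoing under_nw d;
  one_component : forall d d', outgoing under_nw d -> outgoing under_nw d' ->
    fconnect (across (n := ncross) \o mate) d d';
  face_of_orbit : forall d d',
    (face_of d == face_of d') = fconnect (cw (n := ncross) \o mate) d d';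
  face_of_onto : (0 < ncross)%N -> forall f, exists d, face_of d = f
}.

Notation crossing D := 'I_(ncross D).
Notation face D := 'I_(ncross D).+2.
Notation corner D := (dart (ncross D)).

Definition left_face (D : knot_diagram) (d : corner D) : face D := face_of d.
Definition right_face (D : knot_diagram) (d : corner D) : face D :=
  face_of (cw d).

(* The first case concerns the crossingless circle, whose only edge has no
   half-edges. *)
Definition adjacent (D : knot_diagram) (f g : face D) : bool :=
  (ncross D == 0%N) && (f != g)
  || [exists d : corner D, (left_face d == f) && (right_face d == g)].

(** * Fox calculus *)

(* The letter [(j, false)] is the generator [A_j] of the free group and
   [(j, true)] is its inverse.  Words need not be reduced: the Fox derivatives,
   followed by the maps considered below, are compatible with reduction. *)
Definition word (m : nat) := seq ('I_m * bool).

(* A list of terms [(c, u)] stands for the sum of the [c u] in the integral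
   group ring of the free group. *)
Definition groupring (m : nat) := seq (int * word m).

Fixpoint fox m (j : 'I_m) (u : word m) : groupring m :=
  if u is (i, b) :: v then
    (if i == j then [:: if b then (-1, [:: (i, true)]) else (1, [::])]
     else [::])
    ++ [seq (a.1, (i, b) :: a.2) | a <- fox j v]
  else [::].

(* The homomorphism from the free group to [int] sending [A_j] to [w j]. *)
Definition word_hom m (w : 'I_m -> int) (u : word m) : int :=
  \sum_(l <- u) (if l.2 then - w l.1 else w l.1).

(** * The Alexander polynomial *)

(* [Z[t, t^-1]] is considered inside its field of fractions. *)
Notation laurent := {fraction {poly int}}.

Definition tvar : laurent := tofrac 'X.

Definition doteq (p q : laurent) : Prop :=
  exists (s : bool) (k : int), p = (-1) ^+ s * tvar ^ k * q.

(* The extension to group rings of the homomorphism [A_j |-> t ^ (w j)]. *)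
Definition groupring_eval m (w : 'I_m -> int) (a : groupring m) : laurent :=
  \sum_(c <- a) c.1%:~R * tvar ^ word_hom w c.2.

(* The generators [A_1, ..., A_m] are indexed by ['I_m], the index [j] being
   that of the face [lift ord0 j], and [A_0 = 1]. *)
Definition face_word (D : knot_diagram) (f : face D) (b : bool) :
    word (ncross D).+1 :=
  if unlift ord0 f is Some j then [:: (j, b)] else [::].

(* [A_4 A_2^-1 A_1 A_3^-1], the faces [a_1, a_2, a_3, a_4] being those at the
   corners North, West, East, South. *)
Definition dehn_relator (D : knot_diagram) (x : crossing D) :
    word (ncross D).+1 :=
  face_word (face_of (south x)) false ++ face_word (face_of (west x)) true
  ++ face_word (face_of (north x)) false ++ face_word (face_of (east x)) true.

(* The loop going down on the right of the edge directed by [d] and returning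
   up on its left; by the right-hand rule its linking number with an edge
   oriented along [d] is [+1]. *)
Definition meridian (D : knot_diagram) (d : corner D) : word (ncross D).+1 :=
  face_word (right_face d) false ++ face_word (left_face d) true.

(* [A_j |-> t ^ (w j)] factors through the knot group and sends the positively
   linking meridians to [t]. *)
Definition is_abelianization (D : knot_diagram)
    (w : 'I_(ncross D).+1 -> int) : Prop :=
  (forall x : crossing D, word_hom w (dehn_relator x) = 0) /\
  (forall d : corner D, outgoing (@under_nw D) d ->
     word_hom w (meridian d) = 1).

Definition alexander_matrix (D : knot_diagram) (w : 'I_(ncross D).+1 -> int) :
    'M[laurent]_(ncross D, (ncross D).+1) :=
  \matrix_(x, j) groupring_eval w (fox j (dehn_relator x)).

Definition is_alexander_polynomial (D : knot_diagram) (p : laurent) : Prop :=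
  exists (w : 'I_(ncross D).+1 -> int) (j : 'I_(ncross D).+1),
    [/\ is_abelianization w, adjacent ord0 (lift ord0 j)
      & doteq p (\det (col' j (alexander_matrix w) : 'M_(ncross D)))].

(** * Dimer coverings *)

Record bigraph := Bigraph {
  vertex1 : finType;
  vertex2 : finType;
  bedge : finType;
  end1 : bedge -> vertex1;
  end2 : bedge -> vertex2
}.

Definition dimer_covering (G : bigraph) (m : {set bedge G}) : bool :=
  [forall v, #|[set e in m | end1 e == v]| == 1%N]
  && [forall v, #|[set e in m | end2 e == v]| == 1%N].

Definition dimer_sum (R : comNzRingType) (G : bigraph) (mu : bedge G -> R) : R :=
  \sum_(m : {set bedge G} | dimer_covering m) \prod_(e in m) mu e.

(** * The Alexander graph *)

Section AlexanderGraph.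
Variables (D : knot_diagram) (f1 f2 : face D).

Definition kept_face (f : face D) : bool := (f != f1) && (f != f2).

Definition alexander_graph : bigraph :=
  @Bigraph (crossing D) {f : face D | kept_face f}
    {d : corner D | kept_face (face_of d)}
    (fun e => (val e).1) (fun e => Sub (face_of (val e)) (valP e)).

Definition alexander_edge : finType := bedge alexander_graph.

Definition edge_corner (e : alexander_edge) : corner D := val e.

Definition local_weight (e : alexander_edge) : {poly int} :=
  if ((edge_corner e).2 == 0) || ((edge_corner e).2 == 1) then 'X else 1.

Definition share_vertex : rel alexander_edge :=
  [rel e e' | (end1 e == end1 e') || (end2 e == end2 e')].

Definition component (e : alexander_edge) : {set alexander_edge} :=
  [set e' | connect share_vertex e e'].

(* Joining every crossing to the centers of the faces at all of its corners
   cuts the plane into one quadrilateral around each edge of the diagram,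
   represented here by the half-edges of that edge.  The segment at the corner
   [d] separates the quadrilaterals around the half-edges [d] and [ccw d].
   Hence the complement in the plane of a subgraph [C] is obtained by gluing
   the quadrilaterals of [d] and [ccw d] for all corners [d] not used by [C],
   and the faces of [C] are the classes of the resulting connectedness. *)
Definition glued (C : {set alexander_edge}) : rel (corner D) :=
  [rel d d' | [|| d' == mate d,
     (d' == ccw d) && (d \notin edge_corner @: C)
   | (d == ccw d') && (d' \notin edge_corner @: C)]].

Definition region (C : {set alexander_edge}) (d : corner D) :
    {set corner D} :=
  [set d' | connect (glued C) d d'].

(* The number of times [e] occurs on the boundary of the face [F]. *)
Definition incidence (F : {set corner D}) (e : alexander_edge) : nat :=
  ((edge_corner e \in F) + (ccw (edge_corner e) \in F))%N.

Definition boundary_length (C : {set alexander_edge}) (F : {set corner D}) :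
    nat :=
  (\sum_(e in C) incidence F e)%N.

Definition boundary_negatives (eps : alexander_edge -> int)
    (C : {set alexander_edge}) (F : {set corner D}) : nat :=
  (\sum_(e in C | (eps e == -1)%R) incidence F e)%N.

(* The position of the point at infinity: the quadrilateral of the unbounded
   face [0] which contains it (if the vertex of the unbounded face is kept,
   the unbounded face of the Alexander graph depends on how the edges at that
   vertex are drawn).  There is none if the diagram has no crossing. *)
Definition is_infinity (o : option (corner D)) : bool :=
  if o is Some d then face_of d == ord0 else ncross D == 0%N.

Definition is_bounded (o : option (corner D)) (F : {set corner D}) : bool :=
  if o is Some d then d \notin F else true.

Definition kasteleyn_weighting (o : option (corner D))
    (eps : alexander_edge -> int) : Prop :=
  (forall e, (eps e == 1) || (eps e == -1)) /\
  (forall (e : alexander_edge) (d : corner D),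
     let C := component e in
     let F := region C d in
     is_bounded o F ->
     ((boundary_length C F = 0 %[mod 4])%N -> odd (boundary_negatives eps C F)) /\
     ((boundary_length C F = 2 %[mod 4])%N -> ~~ odd (boundary_negatives eps C F))).

End AlexanderGraph.

(* Main.v *)
(* Fox calculus turns the relators into the n x (n+2) matrix with rows
   t N - t W + S - E.  The columns 1 and t^w, where w is the abelianization, lie
   in its kernel, so its maximal minors are proportional to t^w(g) - t^w(f),
   which is a unit times t - 1 for adjacent faces f and g: up to units, the two
   disregarded faces do not matter.  As w changes parity across each edge of the
   diagram, the signs N - W + S - E contribute the same sign to all terms of the
   determinant, and it remains to see that [sgn(m) prod_(e in m) eps(e)] does not
   depend on the dimer covering [m].

   This is Kasteleyn's theorem.  Two coverings differ by disjoint alternating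
   cycles, one for each orbit O of the quotient permutation, and the product of
   [eps] along a cycle has to be (-1)^(|O|+1).  The Jordan curve theorem and
   Euler's formula are replaced by linear algebra over F_2.  The Euler relation
   of the diagram and its connectedness make the cellular chain complex of the
   sphere exact by a comparison of ranks, so the cycle bounds a set R of
   quadrilaterals not containing infinity.  Multiplying the Kasteleyn conditions
   of the regions inside R gives the exponent |R n C| + #regions, where C is the
   component of the cycle.  The minimality of the cycle makes the chain complex
   of the part of C in the closed disc R exact as well, which counts its regions
   as #edges - #vertices + 1, and the number of its vertices is even because a
   dimer covering matches them. *)

Require Import Defs.
From mathcomp Require Import all_boot all_order all_algebra all_fingroup.
From mathcomp Require Import ring zify.

Import GRing.Theory.
Local Open Scope ring_scope.

(** * Maximal minors of a matrix with a two-dimensional kernel *)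

Section Minors.
Variables (F : fieldType) (n : nat).

(** Two distinct indices are encoded as [f] and [lift f g]; the remaining ones are then listed by
    [lift f (lift g j)]. *)
Definition pick2 (f : 'I_(2 + n)) (g : 'I_(1 + n)) : 'M[F]_(2, 2 + n) :=
  \matrix_(i, j) (j == if i == 0 then f else lift f g)%:R.

Definition drop2 (f : 'I_(2 + n)) (g : 'I_(1 + n)) : 'M[F]_(2 + n, n) :=
  \matrix_(i, j) (i == lift f (lift g j))%:R.

Lemma sum_delta (T : finType) (a : T) (G : T -> F) :
  \sum_i (i == a)%:R * G i = G a.
Proof.
rewrite (bigD1 a) //= eqxx mul1r big1 ?addr0 // => i /negPf->.
by rewrite mul0r.
Qed.

Lemma sum_delta_sym (T : finType) (a : T) (G : T -> F) :
  \sum_i (a == i)%:R * G i = G a.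
Proof. by rewrite -[RHS]sum_delta; apply: eq_bigr => i _; rewrite eq_sym. Qed.

Lemma det_mx22 (A : 'M[F]_2) : \det A = A 0 0 * A 1 1 - A 1 0 * A 0 1.
Proof.
rewrite (expand_det_col A 0) !big_ord_recl big_ord0 addr0 /cofactor !det_mx11.
rewrite !mxE /= expr0 expr1 mul1r mulN1r mulrN.
by congr (A _ _ * A _ _ - A _ _ * A _ _); apply: val_inj.
Qed.

Lemma mul_pick2 p (U : 'M[F]_(2 + n, p)) f g i j :
  (pick2 f g *m U) i j = U (if i == 0 then f else lift f g) j.
Proof.
rewrite mxE -[RHS](sum_delta _ (if i == 0 then f else lift f g) (fun k => U k j)).
by apply: eq_bigr => k _; rewrite mxE.
Qed.

Lemma mul_drop2 p (M : 'M[F]_(p, 2 + n)) f g i j :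
  (M *m drop2 f g) i j = M i (lift f (lift g j)).
Proof.
rewrite mxE -[RHS](sum_delta _ (lift f (lift g j)) (fun k => M i k)).
by apply: eq_bigr => k _; rewrite mxE mulrC.
Qed.

Lemma pick2_tr f g : pick2 f g *m (pick2 f g)^T = 1%:M.
Proof.
apply/matrixP=> i j; rewrite mul_pick2 !mxE.
by case: i j => [[|[|[]]] Hi] // [[|[|[]]] Hj] //=;
  rewrite ?eqxx // ?(negPf (neq_lift _ _)) // eq_sym (negPf (neq_lift _ _)).
Qed.

Lemma pick2_drop2 f g : pick2 f g *m drop2 f g = 0.
Proof.
apply/matrixP=> i j; rewrite mul_drop2 !mxE.
case: ifP => _; first by rewrite eq_sym (negPf (neq_lift _ _)).
by rewrite (inj_eq (@lift_inj _ _)) eq_sym (negPf (neq_lift _ _)).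
Qed.

Lemma drop2_tr f g : (drop2 f g)^T *m drop2 f g = 1%:M.
Proof.
apply/matrixP=> i j; rewrite mul_drop2 !mxE.
by rewrite !(inj_eq (@lift_inj _ _)) eq_sym.
Qed.

Definition front2 f g : 'M[F]_(2 + n) := col_mx (pick2 f g) (drop2 f g)^T.

Lemma front2_tr f g : (front2 f g)^T = row_mx (pick2 f g)^T (drop2 f g).
Proof. by rewrite /front2 tr_col_mx trmxK. Qed.

(** The matrix is orthogonal, so its determinant squares to 1; the sign is immaterial up to
    [doteq]. *)
Lemma det_front2 f g : exists b : bool, \det (front2 f g) = (-1) ^+ b.
Proof.
have: \det (front2 f g) ^+ 2 == 1.
  rewrite expr2 -{2}det_tr -det_mulmx front2_tr /front2 mul_col_row.
  rewrite pick2_tr pick2_drop2 drop2_tr -[X in block_mx _ _ X _]trmxK.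
  rewrite trmx_mul !trmxK pick2_drop2 trmx0 -scalar_mx_block.
  by rewrite det1.
by rewrite sqrf_eq1 => /orP[]/eqP->; [exists false | exists true].
Qed.

(* Cramer's rule for a kernel of dimension two: multiply [M], completed by the
   rows [f] and [g] of the identity, with [U], completed by the columns of the
   identity other than [f'] and [g']; the product is block triangular. *)
Lemma minors_proportional (M : 'M[F]_(n, 2 + n)) (U : 'M[F]_(2 + n, 2)) f g f' g' :
  M *m U = 0 -> exists b : bool,
  \det (M *m drop2 f g) * \det (pick2 f' g' *m U) =
  (-1) ^+ b * (\det (M *m drop2 f' g') * \det (pick2 f g *m U)).
Proof.
move=> MU0.
have E1 : \det (col_mx (pick2 f g) M) * \det (front2 f g) = \det (M *m drop2 f g).
  rewrite -[\det (front2 _ _)]det_tr -det_mulmx front2_tr mul_col_row.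
  by rewrite pick2_tr pick2_drop2 det_lblock det1 mul1r.
have E2 : \det (front2 f' g') * \det (row_mx U (drop2 f' g'))
    = \det (pick2 f' g' *m U).
  rewrite -det_mulmx /front2 mul_col_row pick2_drop2 drop2_tr det_lblock.
  by rewrite det1 mulr1.
have E3 : \det (col_mx (pick2 f g) M) * \det (row_mx U (drop2 f' g'))
    = \det (pick2 f g *m U) * \det (M *m drop2 f' g').
  by rewrite -det_mulmx mul_col_row MU0 det_ublock.
rewrite -E1 -E2 [\det (M *m drop2 f' g') * _]mulrC -E3.
have [b ->] := det_front2 f g; have [b' ->] := det_front2 f' g'.
by exists (b (+) b'); rewrite signr_addb; ring.
Qed.

End Minors.

(** * The Alexander matrix *)

Lemma doteq_refl p : doteq p p.
Proof. by exists false, 0; rewrite expr0 expr0z !mul1r. Qed.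

Lemma tvar_neq0 : tvar != 0.
Proof. by rewrite /tvar tofrac_eq0 polyX_eq0. Qed.

Lemma tvar_sub1_neq0 : tvar - 1 != 0.
Proof.
rewrite subr_eq0 /tvar -tofrac1 tofrac_eq.
by apply/eqP=> /(congr1 (fun p : {poly int} => p`_0)); rewrite coefX coef1.
Qed.

Lemma doteq_sym p q : doteq p q -> doteq q p.
Proof.
case=> s [k ->]; exists s, (- k).
by rewrite mulrA mulrACA -signr_addb addbb mul1r -expfzDr ?tvar_neq0 // addNr mul1r.
Qed.

Lemma doteq_trans q p r : doteq p q -> doteq q r -> doteq p r.
Proof.
case=> s [k ->] [s' [k' ->]]; exists (s (+) s'), (k + k').
by rewrite mulrA mulrACA -signr_addb -expfzDr ?tvar_neq0.
Qed.

Lemma doteq_sign (b : bool) p q : p = (-1) ^+ b * q -> doteq p q.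
Proof. by move=> ->; exists b, 0; rewrite expr0z mulr1. Qed.

Lemma doteq_mul p q p' q' : doteq p p' -> doteq q q' -> doteq (p * q) (p' * q').
Proof.
case=> s [k ->] [s' [k' ->]]; exists (s (+) s'), (k + k').
by rewrite mulrACA [X in X * _]mulrACA -signr_addb -expfzDr ?tvar_neq0.
Qed.

Lemma doteq_mulIr r p q : r != 0 -> doteq (p * r) (q * r) -> doteq p q.
Proof.
by move=> r0 [s [k]]; rewrite mulrA => /(mulIf r0) ->; exists s, k.
Qed.

Lemma sum_I4 (V : zmodType) (G : 'I_4 -> V) :
  \sum_k G k = G 0 + G 1 + G 2%:R + G 3%:R.
Proof.
rewrite !big_ord_recl big_ord0 addr0 !addrA.
by congr (_ + G _ + G _ + G _); apply: val_inj.
Qed.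

(* Stated over an abstract field, as [field] diverges on [laurent]. *)
Lemma fox_row_identity (K : fieldType) (a b t s w n e : K) :
  a != 0 -> b != 0 -> t != 0 ->
  s * 1 + a * t * (w * - a^-1 + a^-1 * (n * 1 + b * e * - (b * t)^-1)) =
  n * t - w * t + s - e.
Proof. by move=> a0 b0 t0; field; rewrite t0 b0 a0. Qed.

(** * Alexander numbering of the faces and the Fox matrix *)

Section FaceWeights.
Variables (D : knot_diagram) (w : 'I_(ncross D).+1 -> int).

(** The Alexander numbering of the faces, normalized to 0 on the unbounded face because
    [A_0 = 1]. *)
Definition face_weight (f : face D) : int :=
  if unlift ord0 f is Some j then w j else 0.

Lemma word_hom_cat m (v : 'I_m -> int) u1 u2 :
  word_hom v (u1 ++ u2) = word_hom v u1 + word_hom v u2.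
Proof. exact: big_cat. Qed.

Lemma word_hom_face_word (f : face D) b :
  word_hom w (face_word f b) = if b then - face_weight f else face_weight f.
Proof.
rewrite /word_hom /face_word /face_weight; case: unliftP => [j _|_].
  by rewrite big_seq1.
by rewrite big_nil oppr0 if_same.
Qed.

Lemma face_of_cw_mate (d : corner D) : face_of (cw (mate d)) = face_of d.
Proof. by apply/eqP; rewrite eq_sym face_of_orbit fconnect1. Qed.

Hypothesis abw : is_abelianization w.

Lemma face_weight_outgoing (d : corner D) : outgoing (@under_nw D) d ->
  face_weight (right_face d) = face_weight (left_face d) + 1.
Proof.
move=> /(abw.2) <-; rewrite /meridian word_hom_cat !word_hom_face_word.
by rewrite addrC subrK.
Qed.

Lemma face_weight_incoming (d : corner D) : ~~ outgoing (@under_nw D) d ->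
  face_weight (left_face d) = face_weight (right_face d) + 1.
Proof.
move=> dN; have := @face_weight_outgoing (mate d).
rewrite outgoing_mate dN => /(_ isT).
by rewrite /right_face /left_face face_of_cw_mate -(face_of_cw_mate (mate d)) mateK.
Qed.

Lemma face_weight_east (x : crossing D) :
  face_weight (face_of (east x)) = face_weight (face_of (north x)) + 1.
Proof.
have := @face_weight_outgoing (north x) isT; rewrite /left_face /right_face.
by congr (face_weight (face_of _) = _); congr pair; apply: val_inj.
Qed.

Lemma face_weight_south (x : crossing D) :
  face_weight (face_of (south x)) = face_weight (face_of (west x)) + 1.
Proof.
have := @face_weight_incoming (south x) isT; rewrite /left_face /right_face.
by congr (_ = face_weight (face_of _) + 1); congr pair; apply: val_inj.
Qed.

(** Consecutive corners are separated by one half-edge, across which the numbering changes by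
    one. *)
Lemma face_weight_ccw (d : corner D) :
  (odd `|face_weight (face_of (ccw d))| = ~~ odd `|face_weight (face_of d)|)%N.
Proof.
have cwccw : cw (ccw d) = d by rewrite /cw /ccw /= addrK; case: (d).
have [/face_weight_outgoing|/face_weight_incoming] :=
  boolP (outgoing (@under_nw D) (ccw d)); rewrite /left_face /right_face cwccw; lia.
Qed.


Lemma groupring_eval_cat m (v : 'I_m -> int) a b :
  groupring_eval v (a ++ b) = groupring_eval v a + groupring_eval v b.
Proof. exact: big_cat. Qed.

Lemma fox_cat m (v : 'I_m -> int) j u1 u2 :
  groupring_eval v (fox j (u1 ++ u2)) =
  groupring_eval v (fox j u1) + tvar ^ word_hom v u1 * groupring_eval v (fox j u2).
Proof.
have evalZ l (a : groupring m) : groupring_eval v [seq (c.1, l :: c.2) | c <- a] =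
    tvar ^ word_hom v [:: l] * groupring_eval v a.
  rewrite /groupring_eval big_map mulr_sumr; apply: eq_bigr => c _ /=.
  by rewrite -(cat1s l c.2) word_hom_cat expfzDr ?tvar_neq0 // mulrCA.
elim: u1 => [|[i b] u1 IH] /=.
  by rewrite /groupring_eval /word_hom !big_nil add0r expr0z mul1r.
rewrite !groupring_eval_cat !evalZ IH mulrDr addrA -(cat1s (i, b) u1) word_hom_cat.
by rewrite expfzDr ?tvar_neq0 // mulrA.
Qed.

Lemma fox_face_word j (f : face D) b :
  groupring_eval w (fox j (face_word f b)) =
  (f == lift ord0 j)%:R * (if b then - tvar ^ (- face_weight f) else 1).
Proof.
rewrite /face_word /face_weight; case: unliftP => [i ->|->]; last first.
  by rewrite /groupring_eval big_nil (negPf (neq_lift _ _)) mul0r.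
rewrite /= cats0 (inj_eq (@lift_inj _ _)) /groupring_eval.
case: eqP => _; last by rewrite big_nil mul0r.
rewrite big_seq1 mul1r /word_hom; case: b => /=.
  by rewrite big_seq1 mulN1r.
by rewrite big_nil mulr1.
Qed.

(** Corners are numbered counterclockwise from North, so [(-1) ^+ k] gives the signs of t N - t W +
    S - E. *)
Definition fox_weight (k : 'I_4) : {poly int} :=
  (-1) ^+ k * (if (k == 0) || (k == 1) then 'X else 1).

(** The column of the unbounded face is kept, so that all pairs of faces can be removed on the same
    footing. A face meeting a crossing at several corners collects all their weights. *)
Definition full_matrix : 'M[{poly int}]_(ncross D, (ncross D).+2) :=
  \matrix_(x, f) \sum_k (face_of (x, k) == f)%:R * fox_weight k.

Definition full_matrix_laurent := map_mx (@tofrac {poly int}) full_matrix.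

Lemma full_matrixE x f : full_matrix_laurent x f =
  (face_of (north x) == f)%:R * tvar - (face_of (west x) == f)%:R * tvar
  + (face_of (south x) == f)%:R - (face_of (east x) == f)%:R.
Proof.
rewrite !mxE rmorph_sum sum_I4 /fox_weight /=.
rewrite !expr0 !expr1 !exprS !rmorphM !rmorph_nat !rmorphN !rmorph1.
rewrite /tvar /north /south /east /west /=.
ring.
Qed.

(** In [A_4 A_2^-1 A_1 A_3^-1] the Fox coefficients are 1, -t^(w4-w2), t^(w4-w2) and
    -t^(w4-w2+w1-w3). Crossing the overstrand gives w4 = w2 + 1 and w3 = w1 + 1, which turns them
    into 1, -t, t, -1. *)
Lemma alexander_matrixE : alexander_matrix w = col' ord0 full_matrix_laurent.
Proof.
apply/matrixP=> x j; rewrite [RHS]mxE full_matrixE mxE /dehn_relator !fox_cat.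
rewrite !word_hom_face_word !fox_face_word /= !mulrA.
rewrite face_weight_east face_weight_south.
rewrite -!invr_expz !(expfzDr _ _ tvar_neq0) expr1z.
by apply: fox_row_identity; rewrite ?expfz_neq0 ?tvar_neq0.
Qed.

Definition two_columns : 'M[laurent]_((ncross D).+2, 2) :=
  \matrix_(f, i) (if i == 0 then 1 else tvar ^ face_weight f).

(** For constants t - t + 1 - 1 = 0; for powers of t the North term cancels the East one, and the
    West term the South one. *)
Lemma full_matrix_two_columns : full_matrix_laurent *m two_columns = 0.
Proof.
have rowE x (z : face D -> laurent) : \sum_f full_matrix_laurent x f * z f =
    (z (face_of (north x)) - z (face_of (west x))) * tvar
    + z (face_of (south x)) - z (face_of (east x)).
  under eq_bigr => f _ do rewrite full_matrixE mulrBl mulrDl mulrBl 2!(mulrAC _ tvar).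
  rewrite !sumrB big_split sumrB /= -!mulr_suml.
  by rewrite !sum_delta_sym -mulrBl.
have t0 := tvar_neq0.
apply/matrixP=> x i; rewrite !mxE.
under eq_bigr => f _ do rewrite [two_columns _ _]mxE.
rewrite rowE; case: (i == 0); first by rewrite subrr mul0r add0r subrr.
rewrite face_weight_east face_weight_south !expfzDr // expr1z.
by rewrite mulrBl addrNK subrr.
Qed.

Lemma det_pick2_two_columns f g :
  \det (pick2 _ _ f g *m two_columns) =
  tvar ^ face_weight (lift f g) - tvar ^ face_weight f.
Proof. by rewrite det_mx22 !mul_pick2 !mxE /= !mul1r. Qed.

Lemma adjacent_tvar f g : (0 < ncross D)%N -> adjacent f g ->
  doteq (tvar ^ face_weight g - tvar ^ face_weight f) (tvar - 1).
Proof.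
rewrite lt0n => /negPf n0; rewrite /adjacent n0 => /existsP[d /andP[/eqP<- /eqP<-]].
have [/face_weight_outgoing->|/face_weight_incoming->] :=
  boolP (outgoing (@under_nw D) d).
  exists false, (face_weight (left_face d)).
  by rewrite expfzDr ?tvar_neq0 // expr1z; ring.
exists true, (face_weight (right_face d)).
by rewrite expfzDr ?tvar_neq0 // expr1z; ring.
Qed.

End FaceWeights.

(** Adjacency is read off a half-edge, whose two sides might a priori be the same face; the
    numbering differs by one across it and separates them. *)
Lemma adjacent_neq (D : knot_diagram) (f g : face D) p :
  is_alexander_polynomial D p -> adjacent f g -> g != f.
Proof.
case=> w [j [abw _ _]] fg.
have [n0|n_gt0] := posnP (ncross D).
  case/orP: fg => [/andP[_]|/existsP[[[i i_lt] _] _]]; first by rewrite eq_sym.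
  by exfalso; move: i_lt; rewrite n0.
apply: contraNneq tvar_sub1_neq0 => gf.
have [b [i]] := doteq_sym _ _ (adjacent_tvar _ _ abw _ _ n_gt0 fg).
by rewrite gf subrr mulr0 => ->.
Qed.

Lemma det_dim0 (R : comNzRingType) n (A : 'M[R]_n) : n = 0%N -> \det A = 1.
Proof. by move=> n0; move: A; rewrite n0 => A; rewrite det_mx00. Qed.

Definition kept_minor (D : knot_diagram) (f : face D) (g : 'I_(ncross D).+1) :
    'M[{poly int}]_(ncross D) :=
  \matrix_(x, j) full_matrix D x (lift f (lift g j)).

Lemma alexander_kept_minor (D : knot_diagram) (f : face D) g p :
  is_alexander_polynomial D p -> adjacent f (lift f g) ->
  doteq p (tofrac (\det (kept_minor D f g))).
Proof.
case=> w [j [abw adj0 pE]] adjf; apply: doteq_trans pE _.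
have [n0|n_gt0] := posnP (ncross D).
  by rewrite !det_dim0 // tofrac1; apply: doteq_refl.
have -> : tofrac (\det (kept_minor D f g)) =
    \det (full_matrix_laurent D *m drop2 _ _ f g).
  by rewrite -det_map_mx; congr (\det _); apply/matrixP=> x k; rewrite mul_drop2 !mxE.
have -> : col' j (alexander_matrix w) = full_matrix_laurent D *m drop2 _ _ ord0 j.
  by rewrite alexander_matrixE //; apply/matrixP=> x k; rewrite mul_drop2 !mxE.
have [b] := minors_proportional _ _ _ _ ord0 j f g (full_matrix_two_columns D w abw).
rewrite !det_pick2_two_columns => /doteq_sign E.
(* Both pairs of faces are adjacent, so the two minors of the kernel are units times t - 1, which
   cancels. *)
apply: (doteq_mulIr (tvar - 1) _ _ tvar_sub1_neq0).
apply: doteq_trans (doteq_trans _ _ _ E _).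
  by apply: doteq_mul (doteq_refl _) _; apply: doteq_sym; apply: adjacent_tvar.
by apply: doteq_mul (doteq_refl _) _; apply: adjacent_tvar.
Qed.

(** * Dimer coverings as matchings *)

Section Matchings.
Variables (D : knot_diagram) (f : face D) (g : 'I_(ncross D).+1).

Definition kept (j : 'I_(ncross D)) : face D := lift f (lift g j).

Lemma kept_inj : injective kept.
Proof. by move=> i j /lift_inj /lift_inj. Qed.

Lemma keptP (h : face D) : reflect (exists j, h = kept j) (kept_face f (lift f g) h).
Proof.
rewrite /kept_face; apply: (iffP andP) => [[hf]|[j ->]]; last first.
  by rewrite /kept !(inj_eq (@lift_inj _ _)) ![_ == g]eq_sym ![_ == f]eq_sym !neq_lift.
case: (unliftP f h) hf => [i -> _|->]; last by rewrite eqxx.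
rewrite (inj_eq (@lift_inj _ _)).
by case: (unliftP g i) => [j -> _|->]; [exists j | rewrite eqxx].
Qed.

(* A dimer covering is encoded by the corner [k x] that it uses at every
   crossing [x], together with the induced bijection [s] from crossings to kept
   faces. *)
Definition matching (k : {ffun 'I_(ncross D) -> 'I_4}) (s : {perm 'I_(ncross D)}) :=
  [forall x, face_of (x, k x) == kept (s x)].

Lemma matchingE k s x : matching k s -> face_of (x, k x) = kept (s x).
Proof. by move=> /forallP/(_ x)/eqP. Qed.

(** Expanding the sums inside the entries as well makes every term a permutation together with a
    corner at each crossing; a term that is not a matching has a zero factor. *)
Lemma det_kept_minor : \det (kept_minor D f g) =
  \sum_(ks | matching ks.1 ks.2)
     (-1) ^+ ks.2 * \prod_x fox_weight (ks.1 x).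
Proof.
rewrite /determinant; under eq_bigr => s _.
  under eq_bigr => x _ do rewrite !mxE.
  rewrite bigA_distr_bigA mulr_sumr; over.
rewrite exchange_big /= pair_big big_mkcond /= [RHS]big_mkcond /=.
apply: eq_bigr => -[k s] _ /=; rewrite big_split /=.
case: ifPn => [ks|/forallPn[x xN]].
  by rewrite big1 ?mul1r // => x _; rewrite (matchingE _ _ x ks) eqxx.
by rewrite (bigD1 x) //= (negPf xN) !mul0r mulr0.
Qed.

Notation G := (alexander_graph f (lift f g)).

Definition dimer_of (k : {ffun 'I_(ncross D) -> 'I_4}) : {set bedge G} :=
  [set e | (edge_corner e).2 == k (edge_corner e).1].

Lemma matching_edge k s x : matching k s ->
  kept_face f (lift f g) (face_of (x, k x)).
Proof. by move=> /(matchingE _ _ x) ->; apply/keptP; exists (s x). Qed.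

Lemma dimer_of_covering k s : matching k s -> dimer_covering (dimer_of k).
Proof.
move=> ks; apply/andP; split; apply/forallP=> v; apply/cards1P.
  exists (Sub (v, k v) (matching_edge _ _ v ks)); apply/setP=> e; rewrite !inE.
  apply/andP/eqP => [[/eqP ek /eqP ev]|->]; last by rewrite /= !eqxx.
  by apply: val_inj; rewrite /= -ev -ek -surjective_pairing.
have [j vj] := keptP _ (valP v); pose y := (s^-1)%g j.
have yv : face_of (y, k y) = val v by rewrite (matchingE _ _ y ks) permKV.
exists (Sub (y, k y) (matching_edge _ _ y ks)); apply/setP=> e; rewrite !inE.
apply/andP/eqP => [[/eqP ek /eqP ev]|->]; last by rewrite /= eqxx -val_eqE /= yv.
have fe : face_of (val e) = kept j by rewrite -vj -ev.
have ey : (val e).1 = y.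
  apply: (@perm_inj _ s); rewrite permKV; apply: kept_inj.
  by rewrite -(matchingE _ _ _ ks) -fe -ek -surjective_pairing.
by apply: val_inj; rewrite /= -ey -ek -surjective_pairing.
Qed.

Lemma covering_dimer_of m : dimer_covering m ->
  exists k s, matching k s /\ m = dimer_of k.
Proof.
case/andP=> /forallP m1 /forallP m2.
have /fin_all_exists[E ER] : forall x : crossing D, exists e : bedge G,
    [set e' in m | end1 e' == x] = [set e].
  by move=> x; apply/cards1P; apply: m1.
have /fin_all_exists[S SR] : forall x, exists j, face_of (val (E x)) = kept j.
  by move=> x; apply/keptP; apply: (valP (E x)).
have EP x : E x \in m /\ (val (E x)).1 = x.
  by have := set11 (E x); rewrite -ER inE => /andP[? /eqP].
have Einj e x : e \in m -> (val e).1 = x -> e = E x.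
  by move=> em ex; apply/set1P; rewrite -ER inE em /=; apply/eqP.
have S_inj : injective S.
  move=> x y Sxy; have /cards1P[e0 e0R] := m2 (end2 (E x)).
  have : E x \in [set e0] by rewrite -e0R inE (EP x).1 eqxx.
  have : E y \in [set e0].
    by rewrite -e0R inE (EP y).1 -val_eqE /= !SR Sxy.
  by move=> /set1P Ey /set1P Ex; rewrite -(EP x).2 -(EP y).2 Ex Ey.
exists [ffun x => (val (E x)).2], (perm S_inj); split.
  apply/forallP=> x; rewrite ffunE permE -SR -[in X in (X, _)](EP x).2.
  by rewrite -surjective_pairing.
apply/setP=> e; rewrite inE ffunE; apply/idP/eqP => [em|ek].
  by rewrite /edge_corner -(Einj e).
have -> : e = E (val e).1; last exact: (EP _).1.
apply: val_inj; rewrite [LHS]surjective_pairing [RHS]surjective_pairing (EP _).2.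
by congr pair.
Qed.

Lemma dimer_of_inj k s k' s' : matching k s -> matching k' s' ->
  dimer_of k = dimer_of k' -> (k, s) = (k', s').
Proof.
move=> ks ks' kk'.
have E : k = k'.
  apply/ffunP=> x; have := matching_edge _ _ x ks.
  move=> xP; have : (Sub (x, k x) xP : bedge G) \in dimer_of k by rewrite inE.
  by rewrite kk' inE => /eqP.
rewrite -E in ks' *; congr pair; apply/permP=> x; apply: kept_inj.
by rewrite -(matchingE _ _ x ks) (matchingE _ _ x ks').
Qed.

Lemma dimer_sumE (R : comNzRingType) (mu : corner D -> R) :
  dimer_sum (G := G) (fun e => mu (edge_corner e)) =
  \sum_(ks | matching ks.1 ks.2) \prod_x mu (x, ks.1 x).
Proof.
rewrite /dimer_sum.
rewrite -big_set -[RHS]big_set.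
have -> : [set m : {set bedge G} | dimer_covering m] =
    [set dimer_of ks.1 | ks in [set ks | matching ks.1 ks.2]].
  apply/setP=> m; rewrite inE; apply/idP/imsetP.
    by move=> /covering_dimer_of[k [s [ks ->]]]; exists (k, s); rewrite ?inE.
  by case=> -[k s]; rewrite inE /= => ks ->; apply: dimer_of_covering ks.
rewrite big_imset /=; last first.
  by move=> [k s] [k' s']; rewrite !inE /=; apply: dimer_of_inj.
apply: eq_bigr => -[k s]; rewrite inE /= => ks.
rewrite (reindex_onto (fun x => Sub (x, k x) (matching_edge _ _ x ks) : bedge G)
   (fun e => (edge_corner e).1)) /=; last first.
  move=> e; rewrite inE => /eqP E; apply: val_inj; rewrite /= -E.
  by rewrite -surjective_pairing.
by apply: eq_bigl => x; rewrite inE /= !eqxx.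
Qed.

End Matchings.

(** * Exactness and the Euler relation from ranks *)

Section Ranks.
Variables (F : fieldType) (p q r : nat).

Lemma rank_const_kernel (B : 'M[F]_(q, r)) :
  (forall g : 'cV_r, B *m g = 0 -> exists a, g = const_mx a) ->
  (r <= (\rank B).+1)%N.
Proof.
move=> kerB; have : (\rank (kermx B^T) <= 1)%N.
  apply: leq_trans (rank_leq_row (const_mx 1 : 'rV_r)).
  apply/mxrankS/row_subP=> i.
  have /kerB[a] : B *m (row i (kermx B^T))^T = 0.
    by apply: trmx_inj; rewrite trmx_mul trmxK -row_mul mulmx_ker row0 trmx0.
  move=> /(congr1 trmx); rewrite trmxK trmx_const => ->.
  by apply/sub_rVP; exists a; apply/rowP=> j; rewrite !mxE mulr1.
by rewrite mxrank_ker mxrank_tr leq_subLR addn1.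
Qed.

(** The kernel of [B] contains the image of [A] and has dimension at most q - r + 1 = p - 1, which
    the rank of [A] reaches. *)
Lemma exact_of_ranks (A : 'M[F]_(p, q)) (B : 'M[F]_(q, r)) :
  A *m B = 0 -> (p <= (\rank A).+1)%N -> (r <= (\rank B).+1)%N ->
  (p + r = q + 2)%N -> forall c : 'rV_q, c *m B = 0 -> exists s, c = s *m A.
Proof.
move=> AB rA rB pqr c cB; apply/submxP.
have AK : (A <= kermx B)%MS by apply/sub_kermxP.
have : (kermx B <= A)%MS.
  rewrite -(mxrank_leqif_sup AK) eqn_leq mxrankS //= mxrank_ker; lia.
by apply: submx_trans; apply/sub_kermxP.
Qed.

(** Here p = rank A = q - rank B, and rank B = r - 1 because the kernel of [B] is the line of
    constants. *)
Lemma euler_of_exact (A : 'M[F]_(p, q)) (B : 'M[F]_(q, r)) :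
  (0 < r)%N -> A *m B = 0 -> (forall s : 'rV_p, s *m A = 0 -> s = 0) ->
  (forall c : 'rV_q, c *m B = 0 -> exists s, c = s *m A) ->
  (forall g : 'cV_r, B *m g = 0 <-> exists a, g = const_mx a) ->
  (p + r = q.+1)%N.
Proof.
move=> r0 AB injA exA kerB.
have rB : (r <= (\rank B).+1)%N by apply: rank_const_kernel => g /kerB.
have rB' : (\rank B < r)%N.
  have : B *m const_mx 1 = 0 :> 'cV_q by apply/kerB; exists 1.
  rewrite ltn_neqAle rank_leq_col andbT => B1; apply/negP=> rBr.
  move/row_fullP: rBr => [B' B'B].
  have : const_mx 1 = 0 :> 'cV[F]_r by rewrite -[LHS]mul1mx -B'B -mulmxA B1 mulmx0.
  case: r r0 {B' B'B rB B1 exA kerB AB B injA} => // r' _ /matrixP/(_ 0 0).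
  by rewrite !mxE => /eqP; rewrite oner_eq0.
have rA : \rank A = p.
  apply/eqP; rewrite -[_ == _]/(row_free A); apply: inj_row_free.
  by move=> s; apply: injA.
have : \rank (kermx B) = \rank A.
  apply/eqmx_rank/andP; split; last by apply/sub_kermxP.
  apply/row_subP=> i; have /exA[s ->] : row i (kermx B) *m B = 0.
    by rewrite -row_mul mulmx_ker row0.
  exact: submxMl.
by rewrite mxrank_ker rA; have := rank_leq_row B; lia.
Qed.

End Ranks.

(** * The cellular chain complex of the sphere over F_2 *)

Lemma addF2 (x : 'F_2) : x + x = 0.
Proof. by rewrite -mulr2n mulrn_pchar // pchar_Fp. Qed.

Lemma F2_eq (x y : 'F_2) : x + y = 0 -> x = y.
Proof. by move=> xy; rewrite -[x]addr0 -(addF2 y) addrA xy add0r. Qed.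

Lemma F2_nat (x : 'F_2) : x = (x != 0)%:R.
Proof. by case: x => [[|[|[]]] ?] //; apply: val_inj. Qed.

Lemma F2_add_neq0 (x y : 'F_2) : (x + y != 0) = (x != 0) (+) (y != 0).
Proof. by case: x y => [[|[|[]]] ?] // [[|[|[]]] ?]. Qed.

Lemma natF2 n : n%:R = (odd n)%:R :> 'F_2.
Proof. by rewrite -{1}(odd_double_half n) -addnn natrD natrD addF2 addr0. Qed.

Section Topology.
Variable D : knot_diagram.
Let n := ncross D.

Lemma cw_ccw (d : corner D) : cw (ccw d) = d.
Proof. by rewrite /cw /ccw /= addrK -surjective_pairing. Qed.

Lemma ccw_cw (d : corner D) : ccw (cw d) = d.
Proof. by rewrite /cw /ccw /= subrK -surjective_pairing. Qed.

Lemma ccw_inj : injective (@ccw n).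
Proof. exact: can_inj cw_ccw. Qed.

(** The diagram is connected: its single component visits all outgoing half-edges by [mate] and
    [across], and [across] is two steps of [ccw]. *)
Lemma mate_ccw_constant (T : Type) (h : corner D -> T) :
  (forall d, h (mate d) = h d) -> (forall d, h (ccw d) = h d) ->
  forall d d', h d = h d'.
Proof.
move=> hm hc.
have ha d : h (across d) = h d.
  rewrite -[in RHS]hc -[in RHS]hc /across /ccw /= -addrA.
  by congr (h (_, _ + _)); apply: val_inj.
have hout d d' : outgoing (@under_nw D) d -> outgoing (@under_nw D) d' -> h d = h d'.
  move=> od od'; have /iter_findex <- := one_component od od'.
  by elim: (findex _ _ _) => //= i ->; rewrite ha hm.
have toout d : exists2 d', outgoing (@under_nw D) d' & h d' = h d.
  have [od|od] := boolP (outgoing (@under_nw D) d); first by exists d.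
  by exists (mate d); rewrite ?outgoing_mate.
move=> d d'; have [e oe <-] := toout d; have [e' oe' <-] := toout d'.
exact: hout.
Qed.

(** Such an [h] is a mod 2 chain of quadrilaterals, each being the two half-edges of one edge of the
    diagram. *)
Definition mate_inv (h : corner D -> 'F_2) := forall d, h (mate d) = h d.

(* The boundary of the union of the quadrilaterals on which [h] is [1]. *)
Definition bnd (h : corner D -> 'F_2) d := h d + h (ccw d).

Definition incident (d : corner D) (v : crossing D + face D) : bool :=
  match v with inl x => d.1 == x | inr f => face_of d == f end.

Lemma sum_incident (V : nmodType) (d : corner D) (G : crossing D + face D -> V) :
  \sum_(v | incident d v) G v = G (inl d.1) + G (inr (face_of d)).
Proof.
by rewrite big_sumType /=; congr (_ + _); rewrite (eq_bigl _ _ (eq_sym _)) big_pred1_eq.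
Qed.

Definition cycle2 (c : corner D -> 'F_2) := forall v, \sum_(d | incident d v) c d = 0.

(** Turning around a crossing by [ccw], or around a face by [cw \o mate], every value of [h] is met
    twice and cancels. *)
Lemma bnd_cycle h : mate_inv h -> cycle2 (bnd h).
Proof.
move=> hm v; rewrite big_split /=; case: v => [x|f] /=.
  rewrite [X in _ + X](reindex (@cw n)); last first.
    by exists (@ccw n) => d _; rewrite ?ccw_cw ?cw_ccw.
  by under [X in _ + X]eq_bigr do rewrite ccw_cw; rewrite addF2.
rewrite [X in _ + X](reindex (fun d => cw (mate d))); last first.
  by exists (fun d => mate (ccw d)) => d _; rewrite ?ccw_cw ?mateK ?cw_ccw.
under [X in _ + X]eq_bigl do rewrite face_of_cw_mate.
by under [X in _ + X]eq_bigr do rewrite ccw_cw hm; rewrite addF2.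
Qed.

Lemma vertex_constant (T : Type) (g : crossing D + face D -> T) :
  (0 < n)%N -> (forall d : corner D, g (inl d.1) = g (inr (face_of d))) ->
  forall v v', g v = g v'.
Proof.
move=> n0 gd.
have gc (d d' : corner D) : g (inl d.1) = g (inl d'.1).
  apply: (mate_ccw_constant _ (fun d : corner D => g (inl d.1))) => // e.
  by rewrite -[LHS]/(g (inl (cw (mate e)).1)) gd face_of_cw_mate -gd.
have gv v : exists d : corner D, g v = g (inl d.1).
  case: v => [x|f]; first by exists (x, 0).
  by have [d <-] := @face_of_onto D n0 f; exists d; rewrite gd.
by move=> v v'; have [d ->] := gv v; have [d' ->] := gv v'; apply: gc.
Qed.

(* Every quadrilateral contains exactly one outgoing half-edge. *)
Lemma card_outgoing : #|[set d | outgoing (@under_nw D) d]| = n.*2.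
Proof.
set O := [set d | _].
have : #|O| = #|~: O|.
  rewrite -(card_imset _ (can_inj (@mateK D))); apply: eq_card => d.
  rewrite !inE -outgoing_mate; apply/imsetP/idP => [[e eO ->]|od].
    by rewrite mateK; rewrite inE in eO.
  by exists (mate d); rewrite ?inE ?mateK.
have := cardsC O; rewrite card_prod !card_ord -/n; lia.
Qed.

(** The first homology of the sphere vanishes: 2n quadrilaterals, 4n corners and 2n + 2 vertices
    satisfy 2n + (2n + 2) = 4n + 2, and both rank bounds express connectedness. *)
Lemma cycle_bnd (c : corner D -> 'F_2) : (0 < n)%N -> cycle2 c ->
  exists2 h, mate_inv h & c =1 bnd h.
Proof.
move=> n0 cc.
pose O := [set d | outgoing (@under_nw D) d].
pose out (d : corner D) := if outgoing (@under_nw D) d then d else mate d.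
have outO d : out d \in O.
  by rewrite inE /out; case: ifP => // od; rewrite outgoing_mate od.
have out_mate d : out (mate d) = out d.
  by rewrite /out outgoing_mate mateK; case: (outgoing _ d).
(* The indicator of the quadrilateral of the outgoing half-edge number [i]. *)
pose quad (i : 'I_#|O|) d : 'F_2 := (enum_val i == out d)%:R.
pose A : 'M['F_2]_(#|O|, #|{: corner D}|) := \matrix_(i, e) bnd (quad i) (enum_val e).
pose B : 'M['F_2]_(#|{: corner D}|, #|{: crossing D + face D}|) :=
  \matrix_(e, v) (incident (enum_val e) (enum_val v))%:R.
have BE (z : corner D -> 'F_2) : \row_e z (enum_val e) *m B =
    \row_v \sum_(d | incident d (enum_val v)) z d.
  apply/rowP=> v; rewrite !mxE [RHS]big_mkcond /= [RHS]big_enum_val.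
  apply: eq_bigr => e _; rewrite !mxE; case: ifP; by rewrite ?mulr1 ?mulr0.
have quad_mate i : mate_inv (quad i) by move=> d; rewrite /quad out_mate.
pose hof (s : 'rV_#|O|) d := \sum_i s 0 i * quad i d.
have hof_mate s : mate_inv (hof s).
  by move=> d; apply: eq_bigr => i _; rewrite quad_mate.
have AE s : s *m A = \row_e bnd (hof s) (enum_val e).
  apply/rowP=> e; rewrite !mxE /bnd /hof -big_split /=; apply: eq_bigr => i _.
  by rewrite mxE mulrDr.
have [] := @exact_of_ranks _ _ _ _ A B _ _ _ _ (\row_e c (enum_val e)).
- apply/row_matrixP=> i; rewrite row_mul row0.
  have -> : row i A = \row_e bnd (quad i) (enum_val e) by apply/rowP=> e; rewrite !mxE.
  by rewrite BE; apply/rowP=> v; rewrite !mxE bnd_cycle.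
- rewrite -mxrank_tr; apply: rank_const_kernel => g /(congr1 trmx).
  rewrite trmx_mul trmxK trmx0 AE => /rowP g0.
  have hc d : bnd (hof g^T) d = 0.
    by have := g0 (enum_rank d); rewrite !mxE enum_rankK.
  have d0 : corner D by exact: (Ordinal n0, 0).
  exists (hof g^T d0); apply/colP=> i; rewrite mxE.
  have <- : hof g^T (enum_val i) = g i 0.
    rewrite /hof (bigD1 i) //= big1 => [|j ji].
      have := enum_valP i; rewrite inE /quad /out => ->.
      by rewrite eqxx mulr1 addr0 mxE.
    have := enum_valP i; rewrite inE /quad /out => ->.
    by rewrite (inj_eq enum_val_inj) (negPf ji) mulr0.
  apply: mate_ccw_constant (hof_mate _) _ _ _ => d.
  by apply/esym/F2_eq/hc.
- apply: rank_const_kernel => g Bg.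
  pose gv v := g (enum_rank v) 0.
  have gE (d : corner D) : gv (inl d.1) = gv (inr (face_of d)).
    apply: F2_eq; have /colP/(_ (enum_rank d)) := Bg; rewrite !mxE => <-.
    rewrite -sum_incident big_mkcond big_enum_val.
    apply: eq_bigr => v _; rewrite !mxE enum_rankK /gv enum_valK.
    by case: ifP; rewrite ?mul1r ?mul0r.
  exists (gv (inl (Ordinal n0))); apply/colP=> v; rewrite mxE.
  rewrite -[v in LHS]enum_valK; exact: vertex_constant.
- rewrite card_outgoing card_sum card_prod !card_ord -/n; lia.
- by rewrite BE; apply/rowP=> v; rewrite !mxE cc.
move=> s; rewrite AE => /rowP cs; exists (hof s) => // d.
by have := cs (enum_rank d); rewrite !mxE enum_rankK.
Qed.

End Topology.

(** * Alternating cycles *)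

Lemma connect_inv (T : finType) (e : rel T) (P : T -> Prop) x y :
  (forall u v, e u v -> P u -> P v) -> connect e x y -> P x -> P y.
Proof.
move=> eP /connectP[p]; elim: p x => [|z p IH] x /= => [_ -> //|].
by case/andP=> xz zp yp /(eP _ _ xz); apply: IH.
Qed.

Section AlternatingCycle.
Variables (D : knot_diagram) (f : face D) (g : 'I_(ncross D).+1).
Variables (k k' : {ffun crossing D -> 'I_4}) (s s' : {perm crossing D}).
Hypotheses (ks : matching D f g k s) (ks' : matching D f g k' s').
(** From a crossing, [k'] leads to a face, and [k] from that face to the next crossing of the
    alternating cycle. *)
Let pi : {perm crossing D} := (s' * s^-1)%g.
Variable x0 : crossing D.
Hypothesis kx0 : k x0 != k' x0.
Let O := porbit pi x0.

Lemma switch_face y : face_of (y, k' y) = face_of (pi y, k (pi y)).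
Proof. by rewrite (matchingE _ _ _ _ _ _ ks) (matchingE _ _ _ _ _ _ ks') permM permKV. Qed.

Lemma orbit_ind (P : crossing D -> Prop) :
  P x0 -> (forall y, y \in O -> P y -> P (pi y)) -> forall y, y \in O -> P y.
Proof.
move=> P0 PS y /porbitP[i ->]; elim: i => [|i IH]; first by rewrite expg0 perm1.
by rewrite expgSr permM; apply: PS IH; apply: mem_porbit.
Qed.

Lemma mem_orbit_perm y : (pi y \in O) = (y \in O).
Proof.
by rewrite /O -!eq_porbit_mem -[pi y]/((pi ^+ 1)%g y) porbit_perm.
Qed.

(** A crossing where [k] and [k'] agree is fixed by [pi], so its orbit is a single crossing, which
    would be [x0]. *)
Lemma orbit_switch y : y \in O -> k y != k' y.
Proof.
move=> yO; apply: contra kx0 => /eqP kk.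
have piy : pi y = y.
  apply: (@perm_inj _ s); apply: (kept_inj D f g).
  by rewrite -!(matchingE _ _ _ _ _ _ ks) -switch_face kk.
move: yO; rewrite /O porbit_sym => /porbitP[i ->].
have -> : (pi ^+ i)%g y = y.
  by elim: i => [|i IH]; rewrite ?expg0 ?perm1 // expgSr permM IH.
by rewrite kk.
Qed.

(** A chain on the edges of the cycle, with coefficients [a] on the edges of [k] and [b] on those of
    [k']. *)
Definition on_orbit (a b : crossing D -> 'F_2) (d : corner D) : 'F_2 :=
  (d.1 \in O)%:R * ((d.2 == k d.1)%:R * a d.1 + (d.2 == k' d.1)%:R * b d.1).

Lemma sum_on_orbit a b (mu : corner D -> 'F_2) :
  \sum_d mu d * on_orbit a b d =
  \sum_(y in O) (mu (y, k y) * a y + mu (y, k' y) * b y).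
Proof.
transitivity (\sum_y \sum_j mu (y, j) * on_orbit a b (y, j)).
  by rewrite pair_bigA; apply: eq_bigr => -[].
rewrite [RHS]big_mkcond.
apply: eq_bigr => y _; rewrite /on_orbit /=.
case: (y \in O); last by rewrite big1 // => j _; rewrite mul0r mulr0.
under eq_bigr do rewrite mul1r mulrDr !(mulrCA (mu _)).
by rewrite big_split /= !sum_delta.
Qed.

Lemma sum_on_orbit_crossing a b x :
  \sum_(d | incident D d (inl x)) on_orbit a b d = (x \in O)%:R * (a x + b x).
Proof.
rewrite big_mkcond /=.
transitivity (\sum_d (d.1 == x)%:R * on_orbit a b d).
  by apply: eq_bigr => d _; case: ifP; rewrite ?mul1r ?mul0r.
rewrite (sum_on_orbit _ _ (fun d => (d.1 == x)%:R)) big_mkcond /=.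
rewrite (bigD1 x) //= eqxx !mul1r big1 ?addr0; first by case: ifP; rewrite ?mul1r ?mul0r.
by move=> y /negPf->; rewrite !mul0r addr0 if_same.
Qed.

Lemma sum_on_orbit_face a b h :
  \sum_(d | incident D d (inr h)) on_orbit a b d =
  \sum_(y in O) (face_of (y, k y) == h)%:R * a y
   + \sum_(y in O) (face_of (y, k' y) == h)%:R * b y.
Proof.
rewrite big_mkcond /= -big_split -(sum_on_orbit _ _ (fun d => (face_of d == h)%:R)).
by apply: eq_bigr => d _; case: ifP; rewrite ?mul1r ?mul0r.
Qed.

Definition alt_cycle := on_orbit (fun=> 1) (fun=> 1).

Lemma alt_cycle_left y : y \in O -> alt_cycle (y, k y) = 1.
Proof.
move=> yO; rewrite /alt_cycle /on_orbit /= yO eqxx (negPf (orbit_switch y yO)).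
by rewrite mul0r addr0 !mul1r.
Qed.

Lemma alt_cycle_right y : y \in O -> alt_cycle (y, k' y) = 1.
Proof.
move=> yO; rewrite /alt_cycle /on_orbit /= yO eqxx [_ == k y]eq_sym.
rewrite (negPf (orbit_switch y yO)).
by rewrite mul0r add0r !mul1r.
Qed.

Lemma alt_cycle_neq0 d : alt_cycle d != 0 ->
  d.1 \in O /\ (d = (d.1, k d.1) \/ d = (d.1, k' d.1)).
Proof.
case: d => y j; rewrite /alt_cycle /on_orbit /=.
case: (y \in O); last by rewrite mul0r eqxx.
have [->|_] := eqVneq j (k y); first by split=> //; left.
have [->|_] := eqVneq j (k' y); first by split=> //; right.
by rewrite !mul0r addr0 mulr0 eqxx.
Qed.

Lemma alt_cycle_cycle2 : cycle2 D alt_cycle.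
Proof.
case=> [x|h]; first by rewrite sum_on_orbit_crossing addF2 mulr0.
rewrite sum_on_orbit_face [X in X + _](reindex_inj (@perm_inj _ pi)) /=.
under eq_bigl do rewrite mem_orbit_perm.
by under eq_bigr do rewrite -switch_face; rewrite addF2.
Qed.

(** Coefficients propagate along the orbit: the cycle condition at a crossing equates its two edges,
    and the condition at a face equates the [k'] edge of [y] with the [k] edge of [pi y]. *)
Lemma alt_cycle_minimal c' : cycle2 D c' ->
  (forall d, alt_cycle d = 0 -> c' d = 0) -> c' =1 (fun=> 0) \/ c' =1 alt_cycle.
Proof.
move=> cc' supp; pose a y := c' (y, k y); pose b y := c' (y, k' y).
have c'E d : c' d = on_orbit a b d.
  case: d => y j; rewrite /on_orbit /=.
  have [yO|yO] := boolP (y \in O); last first.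
    by rewrite mul0r supp // /alt_cycle /on_orbit /= (negPf yO) mul0r.
  have ne := orbit_switch y yO; rewrite mul1r.
  have [->|jk] := eqVneq j (k y); first by rewrite (negPf ne) mul0r addr0 mul1r.
  have [->|jk'] := eqVneq j (k' y); first by rewrite mul0r add0r mul1r.
  rewrite !mul0r addr0 supp // /alt_cycle /on_orbit /= (negPf jk) (negPf jk').
  by rewrite !mul0r addr0 mulr0.
have ab y : y \in O -> a y = b y.
  move=> yO; apply: F2_eq; have := cc' (inl y); rewrite (eq_bigr (on_orbit a b)) //.
  by rewrite sum_on_orbit_crossing yO mul1r.
have ba y : y \in O -> b y = a (pi y).
  move=> yO; apply: F2_eq; have := cc' (inr (face_of (y, k' y))).
  rewrite (eq_bigr (on_orbit a b)) // sum_on_orbit_face addrC => <-; congr (_ + _).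
    rewrite (bigD1 y) //= eqxx mul1r big1 ?addr0 // => z /andP[_ zy].
    rewrite !(matchingE _ _ _ _ _ _ ks') (inj_eq (kept_inj _ _ _)).
    by rewrite (inj_eq perm_inj) (negPf zy) mul0r.
  rewrite switch_face (bigD1 (pi y)) ?mem_orbit_perm //= eqxx mul1r big1 ?addr0 //.
  move=> z /andP[_ zy]; rewrite !(matchingE _ _ _ _ _ _ ks) (inj_eq (kept_inj _ _ _)).
  by rewrite (inj_eq perm_inj) (negPf zy) mul0r.
have ax0 y : y \in O -> a y = a x0.
  by apply: (orbit_ind (fun y => a y = a x0)) => // z zO <-; rewrite -ba // ab.
have onE d : c' d = a x0 * alt_cycle d.
  rewrite c'E /alt_cycle /on_orbit; have := ax0 d.1; have := ab d.1.
  case: (d.1 \in O); last by rewrite !mul0r mulr0.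
  by move=> /(_ isT) <- /(_ isT) ->; rewrite !mul1r !mulr1 -mulrDl mulrC.
have [a0|a1] := eqVneq (a x0) 0; [left|right] => d; rewrite onE.
  by rewrite a0 mul0r.
by rewrite (F2_nat (a x0)) a1 mul1r.
Qed.


Lemma card_alt_cycle : #|[set d | alt_cycle d != 0]| = #|O|.*2.
Proof.
have -> : [set d | alt_cycle d != 0] =
    [set (y, k y) | y in O] :|: [set (y, k' y) | y in O].
  apply/setP=> d; rewrite !inE; apply/idP/orP => [/alt_cycle_neq0[dO]|].
    by case=> E; [left | right]; apply/imsetP; exists d.1.
  by case=> /imsetP[y yO ->]; rewrite ?alt_cycle_left ?alt_cycle_right ?oner_eq0.
rewrite cardsU disjoint_setI0 ?cards0 ?subn0; last first.
  rewrite -setI_eq0; apply/eqP/setP=> d; rewrite !inE; apply/andP=> -[].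
  move=> /imsetP[y yO ->] /imsetP[z zO [<- E]].
  by move: (orbit_switch y yO); rewrite E eqxx.
by rewrite !card_imset ?addnn // => y z [].
Qed.

(** * Regions of the component containing the cycle *)

Notation edge := (alexander_edge f (lift f g)).

Variables (eps : edge -> int) (infinity : corner D).
Hypothesis heps : kasteleyn_weighting (Some infinity) eps.

Let e0 : edge := Sub (x0, k x0) (matching_edge _ _ _ _ _ x0 ks).
Let C := component e0.
Let Cd : {set corner D} := @edge_corner D f (lift f g) @: C.

Lemma component_mem d : kept_face f (lift f g) (face_of d) ->
  (exists2 e, e \in Cd & (e.1 == d.1) || (face_of e == face_of d)) -> d \in Cd.
Proof.
move=> dk [_ /imsetP[e eC ->] ed]; apply/imsetP; exists (Sub d dk : edge) => //.
rewrite inE in eC; rewrite inE; apply: connect_trans eC (connect1 _).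
exact: ed.
Qed.

Lemma component_kept d : d \in Cd -> kept_face f (lift f g) (face_of d).
Proof. by case/imsetP=> e _ ->; apply: (valP e). Qed.

Lemma orbit_in_component y : y \in O -> (y, k y) \in Cd.
Proof.
apply: (orbit_ind (fun y => (y, k y) \in Cd)) => [|z zO zC].
  by apply/imsetP; exists e0; rewrite ?inE ?connect0.
have z'C : (z, k' z) \in Cd.
  by apply: component_mem (matching_edge _ _ _ _ _ z ks') _; exists (z, k z); rewrite ?eqxx.
apply: component_mem (matching_edge _ _ _ _ _ (pi z) ks) _.
by exists (z, k' z); rewrite ?switch_face ?eqxx ?orbT.
Qed.

Lemma alt_cycle_in_component d : alt_cycle d != 0 -> d \in Cd.
Proof.
case/alt_cycle_neq0=> dO [->|->]; first exact: orbit_in_component.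
apply: component_mem (matching_edge _ _ _ _ _ _ ks') _.
by exists (d.1, k d.1); rewrite ?orbit_in_component ?eqxx.
Qed.

Lemma glued_sym : symmetric (glued C).
Proof.
apply: symmetric_from_pre => d d' /or3P[/eqP->|dd'|dd'].
- by apply/or3P/Or31; rewrite mateK.
- exact/or3P/Or33.
- exact/or3P/Or32.
Qed.

Lemma region_eq d d' : d' \in region C d -> region C d' = region C d.
Proof.
rewrite inE => dd'; apply/setP=> d''; rewrite !inE.
by rewrite (same_connect (sym_connect_sym glued_sym) dd').
Qed.

Lemma region_constant h d d' : mate_inv D h ->
  (forall e, e \notin Cd -> bnd D h e = 0) -> d' \in region C d -> h d' = h d.
Proof.
move=> hm hb; rewrite inE => dd'.
apply: (connect_inv _ _ (fun e => h e = h d) _ _ _ dd') => // u v uv <-.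
case/or3P: uv => [/eqP->|/andP[/eqP-> /hb/F2_eq]|/andP[/eqP-> /hb/F2_eq]] //.
Qed.

Definition ind (F : {set corner D}) (d : corner D) : 'F_2 := (d \in F)%:R.

Lemma ind_mate d : mate_inv D (ind (region C d)).
Proof.
move=> e; rewrite /ind !inE; congr (nat_of_bool _)%:R.
by apply/idP/idP => de; apply: connect_trans de (connect1 _);
  apply/or3P/Or31; rewrite ?mateK.
Qed.

Lemma ind_ccw d e : e \notin Cd -> (ccw e \in region C d) = (e \in region C d).
Proof.
move=> eC; rewrite !inE.
have eC' : (ccw e == ccw e) && (e \notin Cd) by rewrite eqxx.
apply/idP/idP => de; apply: connect_trans de (connect1 _); apply/or3P.
  exact: Or33.
exact: Or32.
Qed.

Lemma ind_bnd d e : e \notin Cd -> bnd D (ind (region C d)) e = 0.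
Proof. by move=> eC; rewrite /bnd /ind ind_ccw // addF2. Qed.

Lemma sum_component (V : nmodType) (G : corner D -> V) :
  \sum_(e in C) G (edge_corner e) = \sum_(d in Cd) G d.
Proof. by rewrite [RHS]big_imset //= => e e' _ _; apply: val_inj. Qed.

(** As [ccw] permutes all corners and preserves membership in the region off the component, both
    sides of the edges of the component contribute equally. *)
Lemma boundary_length_region d :
  boundary_length C (region C d) = #|region C d :&: Cd|.*2.
Proof.
set F := region C d.
have -> : boundary_length C F = (\sum_(e in Cd) ((e \in F) + (ccw e \in F)))%N.
  exact: (@sum_component nat (fun e => (e \in F) + (ccw e \in F))%N).
have E : (\sum_(e in Cd) (ccw e \in F) = \sum_(e in Cd) (e \in F))%N.
  have : (\sum_e (ccw e \in F) = \sum_e (e \in F))%N.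
    by rewrite [RHS](reindex_inj (@ccw_inj D)).
  rewrite (bigID (mem Cd)) [RHS](bigID (mem Cd)) /= => E; apply/eqP.
  rewrite -(eqn_add2r (\sum_(i | i \notin Cd) (i \in F))) -E; apply/eqP; congr addn.
  by apply: eq_bigr => e eC; rewrite ind_ccw.
rewrite big_split /= E addnn; apply: (congr1 double); rewrite -sum1_card.
rewrite [LHS]big_mkcond [RHS]big_mkcond /=; apply: eq_bigr => e _.
by rewrite in_setI; case: (e \in F); case: (e \in Cd).
Qed.

(* The half-edges of the quadrilaterals enclosed by the cycle form [R], which
   does not contain infinity; [Reg] consists of the faces of the component that
   lie in [R], and [ED], [VD] of its edges and vertices in the closed disc. *)
Variable h : corner D -> 'F_2.
Hypotheses (hm : mate_inv D h) (hc : alt_cycle =1 bnd D h) (hinf : h infinity = 0).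

Let R : {set corner D} := [set d | h d != 0].
Let Reg : {set {set corner D}} := [set region C d | d in R].
Let ED : {set corner D} := [set d in Cd | (h d != 0) || (h (ccw d) != 0)].
Let VD : {set crossing D + face D} := [set v | [exists d in ED, incident D d v]].

Lemma bnd_outside_component d : d \notin Cd -> bnd D h d = 0.
Proof.
by rewrite -hc => dC; apply/eqP; apply: contraNT dC; apply: alt_cycle_in_component.
Qed.

Lemma mem_Reg F d : F \in Reg -> d \in F -> F = region C d /\ h d != 0.
Proof.
case/imsetP=> e; rewrite inE => he -> de.
by rewrite (region_eq _ _ de) (region_constant _ _ _ hm bnd_outside_component de).
Qed.

Lemma region_refl d : d \in region C d.
Proof. by rewrite inE connect0. Qed.

Lemma sum_regions (t : {set corner D} -> 'F_2) d :
  \sum_(F in Reg) t F * ind F d = (h d != 0)%:R * t (region C d).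
Proof.
have [hd|hd] := boolP (h d != 0).
  have FR : region C d \in Reg by apply: imset_f; rewrite inE.
  rewrite (bigD1 (region C d)) //= /ind region_refl mulr1 mul1r big1 ?addr0 //.
  move=> F /andP[FReg Fd]; case: (boolP (d \in F)) => [dF|]; last by rewrite mulr0.
  by rewrite (mem_Reg F d FReg dF).1 eqxx in Fd.
rewrite mul0r big1 // => F FReg; rewrite /ind.
case: (boolP (d \in F)) => [/(mem_Reg F d FReg)[_]|]; last by rewrite mulr0.
by rewrite (negPf hd).
Qed.

Lemma sum_ind d : \sum_(F in Reg) ind F d = h d.
Proof.
rewrite [RHS]F2_nat; have := sum_regions (fun=> 1) d; rewrite mulr1 => <-.
by apply: eq_bigr => F _; rewrite mul1r.
Qed.

Lemma boundary_negatives_region F : F \in Reg ->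
  (boundary_negatives eps C F)%:R = #|F :&: Cd|%:R + 1 :> 'F_2.
Proof.
move=> FReg; have infF : infinity \notin F.
  by apply/negP=> /(mem_Reg F _ FReg)[_]; rewrite hinf eqxx.
case/imsetP: FReg infF => d _ -> infF.
have [l0 l2] := heps.2 e0 d infF.
rewrite -/C boundary_length_region in l0 l2.
rewrite natF2 [X in X + _]natF2.
(* The length is twice this cardinal, hence 2 mod 4 if the cardinal is odd and 0 mod 4 if it is
   even. *)
case: (odd _) (odd_double_half #|region C d :&: Cd|) l0 l2 => /= E l0 l2.
  have -> : odd (boundary_negatives eps C (region C d)) = false.
    apply/negbTE/l2; rewrite -E; set q := _./2; rewrite -!muln2; lia.
  by rewrite addF2.
have -> : odd (boundary_negatives eps C (region C d)).
  apply/l0; rewrite -E; set q := _./2; rewrite -!muln2; lia.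
by rewrite add0r.
Qed.

Definition edge_sign (e : edge) : 'F_2 := (eps e == -1)%:R.

(** When the conditions of all regions in [R] are added, an edge counts once for each of its sides
    in [R]; modulo 2 only the edges of the cycle remain. *)
Lemma sum_edge_sign :
  \sum_(e in C) edge_sign e * alt_cycle (edge_corner e) = #|R :&: Cd|%:R + #|Reg|%:R.
Proof.
have -> : \sum_(e in C) edge_sign e * alt_cycle (edge_corner e) =
    \sum_(F in Reg) (boundary_negatives eps C F)%:R.
  under eq_bigr do rewrite hc /bnd -!sum_ind -big_split mulr_sumr.
  rewrite exchange_big; apply: eq_bigr => F _ /=.
  rewrite /boundary_negatives natr_sum big_mkcondr /=; apply: eq_bigr => e _.
  by rewrite /edge_sign /incidence /ind; case: eqP => _; rewrite ?mul1r ?mul0r ?natrD.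
rewrite (eq_bigr _ boundary_negatives_region) big_split /= sumr_const; congr (_ + _).
transitivity (\sum_(F in Reg) \sum_(d in Cd) ind F d).
  apply: eq_bigr => F _; rewrite -sum1_card natr_sum [RHS]big_mkcond [LHS]big_mkcond /=.
  by apply: eq_bigr => d _; rewrite in_setI /ind; case: (d \in F); case: (d \in Cd).
rewrite exchange_big -sum1_card natr_sum [RHS]big_mkcond [LHS]big_mkcond /=.
apply: eq_bigr => d _; rewrite in_setI inE.
rewrite sum_ind [h d]F2_nat.
by case: (_ != 0); case: (d \in Cd).
Qed.

(** The preimage of [R] under [ccw] has the size of [R], and the two sets differ exactly in the 2|O|
    edges of the cycle, so each difference has |O| elements; [ED] adds one of them to [R :&: Cd]. *)
Lemma card_ED : #|ED| = (#|R :&: Cd| + #|O|)%N.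
Proof.
pose R' := [set d | h (ccw d) != 0].
have cR' : #|R'| = #|R|.
  have -> : R' = (@ccw (ncross D)) @^-1: R by apply/setP=> d; rewrite !inE.
  by rewrite on_card_preimset //; exists (@cw (ncross D)) => d _; rewrite ?cw_ccw ?ccw_cw.
have bndE d : (bnd D h d != 0) = (d \in R) (+) (d \in R').
  by rewrite !inE F2_add_neq0.
have cDD : (#|R :\: R'| + #|R' :\: R|)%N = #|O|.*2.
  rewrite -card_alt_cycle -cardsUI [_ :&: _](_ : _ = set0) ?cards0 ?addn0; last first.
    by apply/setP=> d; rewrite !inE; case: (h d == 0); rewrite ?andbF.
  apply: eq_card => d; rewrite !inE hc bndE !inE.
  by case: (h d == 0); case: (h _ == 0).
have c1 := cardsID R' R; have c2 := cardsID R R'; rewrite setIC in c2.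
have -> : ED = (R :&: Cd) :|: (R' :\: R).
  apply/setP=> d; rewrite !inE; have [dC|dC] := boolP (d \in Cd).
    by case: (h d == 0); case: (h _ == 0).
  have /eqP := bnd_outside_component d dC; rewrite -[_ == _]negbK bndE !inE.
  by case: (h d == 0); case: (h _ == 0).
rewrite cardsU [_ :&: (_ :\: _)](_ : _ = set0) ?cards0; last first.
  by apply/setP=> d; rewrite !inE; case: (h d == 0); rewrite ?andbF.
lia.
Qed.

(** Turning around a vertex off the cycle crosses only corners where [h] does not change. *)
Lemma bounding_constant_at_vertex v d d' : (forall e, incident D e v -> alt_cycle e = 0) ->
  incident D d v -> incident D d' v -> h d = h d'.
Proof.
move=> v0; have hb e : incident D e v -> h e = h (ccw e).
  by move=> ev; apply: F2_eq; rewrite -/(bnd D h e) -hc v0.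
case: v v0 hb => [x|phi] /= v0 hb.
  suff hx (j : 'I_4) : h (x, j) = h (x, 0).
    by case: d d' => [y j] [y' j'] /= /eqP-> /eqP->; rewrite hx [RHS]hx.
  have step (i : 'I_4) : h (x, i + 1) = h (x, i) by rewrite [RHS]hb.
  have -> : j = (j : nat)%:R by rewrite Zp_nat; apply: val_inj; rewrite /= modn_small.
  by elim: (j : nat) => [|i <-] //; rewrite mulrSr step.
move=> /eqP dphi /eqP d'phi.
have /iter_findex <- : fconnect (cw (n := ncross D) \o mate (k := D)) d d'.
  by rewrite -face_of_orbit dphi d'phi.
elim: (findex _ _ _) => [//|i] /=; set e := iter _ _ _ => de.
have ephi : face_of e = phi.
  rewrite -dphi /e; elim: i {de e} => //= i <-; exact: face_of_cw_mate.
by rewrite de [RHS]hb ?face_of_cw_mate ?ephi // ccw_cw hm.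
Qed.

Lemma ED_alt_cycle d : alt_cycle d != 0 -> d \in ED.
Proof.
move=> dc; rewrite inE alt_cycle_in_component //=; move: dc; rewrite hc /bnd.
by apply: contraR; rewrite negb_or !negbK => /andP[/eqP-> /eqP->]; rewrite addr0.
Qed.

Lemma ED_at_vertex v d d' : d \in ED -> incident D d v -> incident D d' v ->
  kept_face f (lift f g) (face_of d') ->
  d' \in ED \/ exists2 e, incident D e v & alt_cycle e != 0.
Proof.
move=> dED dv d'v d'k.
have [/exists_inP[e ev ec]|/exists_inPn v0] :=
  boolP [exists e in incident D ^~ v, alt_cycle e != 0].
  by right; exists e.
left; move: dED; rewrite !inE => /andP[dC hd]; apply/andP; split.
  apply: component_mem => //; exists d => //.
  by case: v dv d'v {v0} => [x|phi] /= /eqP-> /eqP->; rewrite eqxx ?orbT.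
have v0' e : incident D e v -> alt_cycle e = 0 by move=> /v0/negPn/eqP.
have hE e : incident D e v -> h e = h (ccw e).
  by move=> /v0' ec; apply: F2_eq; rewrite -/(bnd D h e) -hc ec.
rewrite -(hE d dv) orbb in hd.
by rewrite -(hE d' d'v) orbb -(bounding_constant_at_vertex v d d' v0' dv d'v).
Qed.

(** The covering [k] pairs the crossings and the face vertices of the disc. At a vertex on the cycle
    the edge of [k] belongs to the cycle; at any other vertex of the disc all edges of the component
    lie in the disc. *)
Lemma card_VD_even : ~~ odd #|VD|.
Proof.
pose V1 := [set x | inl x \in VD]; pose V2 := [set phi | inr phi \in VD].
have -> : #|VD| = (#|V1| + #|V2|)%N.
  rewrite -!sum1_card big_sumType /=; congr addn; apply: eq_bigl => v; by rewrite !inE.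
have kED x : (x \in V1) || (kept D f g (s x) \in V2) -> (x, k x) \in ED.
  have fx := matchingE _ _ _ _ _ x ks.
  have kx := matching_edge _ _ _ _ _ x ks.
  rewrite [x \in V1]inE [inl x \in VD]inE [_ \in V2]inE [inr _ \in VD]inE.
  move=> /orP[] /exists_inP[d dED dx].
    have [//|[e]] := ED_at_vertex (inl x) d (x, k x) dED dx (eqxx x) kx.
    move=> /eqP ex /alt_cycle_neq0[eO _]; rewrite ex in eO.
    by apply: ED_alt_cycle; rewrite alt_cycle_left ?oner_eq0.
  have [//|[e]] := ED_at_vertex (inr _) d (x, k x) dED dx (introT eqP fx) kx.
  move=> /eqP ex /alt_cycle_neq0[eO ek].
  suff xO : x \in O by apply: ED_alt_cycle; rewrite alt_cycle_left ?oner_eq0.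
  case: ek ex => ->; rewrite ?switch_face (matchingE _ _ _ _ _ _ ks).
    by move=> /kept_inj /perm_inj <-.
  by move=> /kept_inj /perm_inj <-; rewrite mem_orbit_perm.
have -> : V2 = [set kept D f g (s x) | x in V1].
  apply/setP=> phi; apply/idP/imsetP => [phiV|[x xV ->]].
    have /keptP[j phiE] : kept_face f (lift f g) phi.
      move: phiV; rewrite !inE => /exists_inP[d]; rewrite inE => /andP[dC _] /eqP<-.
      exact: component_kept.
    rewrite phiE in phiV *; exists ((s^-1)%g j); last by rewrite permKV.
    rewrite !inE; apply/exists_inP; exists ((s^-1)%g j, k ((s^-1)%g j)); last by rewrite /= eqxx.
    by apply: kED; rewrite permKV phiV orbT.
  rewrite !inE; apply/exists_inP; exists (x, k x); first by apply: kED; rewrite xV.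
  by rewrite /= (matchingE _ _ _ _ _ _ ks).
rewrite card_imset ?addnn ?odd_double // => x y /kept_inj; exact: perm_inj.
Qed.

Lemma x0_ED : (x0, k x0) \in ED.
Proof. by apply: ED_alt_cycle; rewrite alt_cycle_left ?porbit_id ?oner_eq0. Qed.

Lemma R_neq0 : exists d, h d != 0.
Proof.
move: x0_ED; rewrite inE => /andP[_ /orP[]]; first by exists (x0, k x0).
by exists (ccw (x0, k x0)).
Qed.

(** * Exactness of the chain complex of the disc *)

Definition combine (t : {set corner D} -> 'F_2) d := \sum_(F in Reg) t F * ind F d.

Lemma combine_mate t : mate_inv D (combine t).
Proof.
by move=> d; apply: eq_bigr => F /imsetP[e _ ->]; rewrite ind_mate.
Qed.

Lemma bnd_combine t d : d \notin ED -> bnd D (combine t) d = 0.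
Proof.
rewrite inE negb_and negb_or !negbK => /orP[dC|/andP[/eqP h0 /eqP h0']].
  rewrite /bnd -big_split big1 // => F /imsetP[e _ ->] /=.
  by rewrite -mulrDr -/(bnd D (ind (region C e)) d) ind_bnd // mulr0.
by rewrite /bnd /combine !sum_regions h0 h0' eqxx !mul0r addr0.
Qed.

Lemma region_representative : exists rep : {set corner D} -> corner D,
  forall d, rep (region C d) \in region C d.
Proof.
(* A region is nonempty, so the default [infinity] is never returned for one. *)
exists (fun F : {set corner D} => odflt infinity [pick d in F]) => d.
by case: pickP => [//|] /(_ d); rewrite region_refl.
Qed.

(* A function on the quadrilaterals whose boundary lies in the component
   vanishes outside [R]: its part outside [R] has its boundary in the
   alternating cycle, which is minimal. *)
Lemma vanish_outside h' : mate_inv D h' -> h' infinity = 0 ->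
  (forall d, d \notin ED -> bnd D h' d = 0) -> forall d, h d = 0 -> h' d = 0.
Proof.
move=> hm' hinf' hb'; pose h3 d := h' d * (1 + h d).
have hm3 : mate_inv D h3 by move=> d; rewrite /h3 hm' hm.
have hinf3 : h3 infinity = 0 by rewrite /h3 hinf' mul0r.
have supp d : alt_cycle d = 0 -> bnd D h3 d = 0.
  rewrite hc => /F2_eq hd; rewrite /bnd /h3 -hd -mulrDl.
  have [h0|h1] := eqVneq (h d) 0.
    have -> : h' d + h' (ccw d) = 0; last by rewrite mul0r.
    by apply: hb'; rewrite inE -hd h0 eqxx andbF.
  by rewrite (F2_nat (h d)) h1 addF2 mulr0.
have const (h4 : corner D -> 'F_2) : mate_inv D h4 -> h4 infinity = 0 ->
    (forall d, bnd D h4 d = 0) -> forall d, h4 d = 0.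
  move=> hm4 hinf4 hb4 d; rewrite -hinf4; apply: mate_ccw_constant => // e.
  by apply/esym/F2_eq/hb4.
have h3E d : h d = 0 -> h3 d = h' d by rewrite /h3 => ->; rewrite addr0 mulr1.
move=> d hd; rewrite -h3E //.
have [b0|bc] := alt_cycle_minimal _ (bnd_cycle D h3 hm3) supp.
  exact: const.
(* If the boundary of [h3] is the whole cycle, then [h3 + h] is constant, hence 0 as at infinity;
   but on [R] the chain [h3] vanishes and [h] does not. *)
have [e he] := R_neq0.
have : h3 e + h e = 0.
  apply: (const (fun d => h3 d + h d)); rewrite ?hinf3 ?hinf ?addr0 //.
    by move=> d'; rewrite hm3 hm.
  move=> d'; rewrite /bnd addrACA -/(bnd D h3 d') bc hc; exact: addF2.
by rewrite /h3 (F2_nat (h e)) he addF2 mulr0 add0r => /eqP; rewrite oner_eq0.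
Qed.

(** A path in the component may leave the disc, but it returns only through a vertex of the cycle,
    along which [gv] is constant. *)
Lemma constant_on_disc (gv : crossing D + face D -> 'F_2) :
  (forall d, d \in ED -> gv (inl d.1) = gv (inr (face_of d))) ->
  forall v, v \in VD -> gv v = gv (inl x0).
Proof.
move=> gE.
have gO y : y \in O -> gv (inl y) = gv (inl x0).
  apply: (orbit_ind (fun y => gv (inl y) = gv (inl x0))) => // z zO <-.
  have := gE (z, k' z); rewrite switch_face /= => ->; last first.
    by apply: ED_alt_cycle; rewrite alt_cycle_right ?oner_eq0.
  apply: (gE (pi z, k (pi z))); apply: ED_alt_cycle.
  by rewrite alt_cycle_left ?mem_orbit_perm ?oner_eq0.
have gv_inc d v : d \in ED -> incident D d v -> gv v = gv (inl d.1).
  by move=> dED; case: v => [x|phi] /= /eqP<- //; rewrite gE.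
have gC e : e \in C -> edge_corner e \in ED -> gv (inl (edge_corner e).1) = gv (inl x0).
  rewrite inE => ee.
  apply: (connect_inv _ _ (fun e : edge => edge_corner e \in ED ->
    gv (inl (edge_corner e).1) = gv (inl x0)) _ _ _ ee) => // u v uv IH vED.
  have [w uw vw] : exists2 w, incident D (edge_corner u) w & incident D (edge_corner v) w.
    case/orP: uv => [/eqP uv|/eqP uv].
      by exists (inl (edge_corner u).1) => /=; rewrite ?eqxx //; apply/eqP.
    exists (inr (face_of (edge_corner u))) => /=; rewrite ?eqxx //.
    by apply/eqP; case: uv.
  rewrite -(gv_inc _ w) //.
  have [uED|[d dw dc]] := ED_at_vertex w _ (edge_corner u) vED vw uw (valP u).
    by rewrite (gv_inc _ w uED) // IH.
  by rewrite (gv_inc d) ?ED_alt_cycle // gO // (alt_cycle_neq0 _ dc).1.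
move=> v; rewrite inE => /exists_inP[d dED dv]; rewrite (gv_inc d) //.
have := dED; rewrite inE => /andP[/imsetP[e eC de] _].
by rewrite de; apply: gC; rewrite -?de.
Qed.

Lemma euler_alt_cycle : (#|Reg| + #|VD| = #|ED|.+1)%N.
Proof.
have [d0 hd0] := R_neq0.
have FR0 : region C d0 \in Reg by apply: imset_f; rewrite inE.
have [rep repP] := region_representative.
pose A : 'M['F_2]_(#|Reg|, #|ED|) := \matrix_(i, e) bnd D (ind (enum_val i)) (enum_val e).
pose B : 'M['F_2]_(#|ED|, #|VD|) := \matrix_(e, v) (incident D (enum_val e) (enum_val v))%:R.
have AE t : \row_i t (enum_val i) *m A = \row_e bnd D (combine t) (enum_val e).
  apply/rowP=> e; rewrite !mxE /bnd /combine -big_split /= [RHS]big_enum_val.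
  by apply: eq_bigr => i _; rewrite !mxE mulrDr.
have BE (z : corner D -> 'F_2) : (forall d, d \notin ED -> z d = 0) ->
    \row_e z (enum_val e) *m B = \row_v \sum_(d | incident D d (enum_val v)) z d.
  move=> z0; apply/rowP=> v; rewrite !mxE.
  transitivity (\sum_(d in ED) z d * (incident D d (enum_val v))%:R).
    by rewrite [RHS]big_enum_val; apply: eq_bigr => e _; rewrite !mxE.
  rewrite [LHS]big_mkcond [RHS]big_mkcond; apply: eq_bigr => d _ /=.
  have [dED|/z0->] := boolP (d \in ED); last by rewrite if_same.
  by case: ifP; rewrite ?mulr1 ?mulr0.
have rowP' (T : finType) (a : T) (X : {set T}) (aX : a \in X) (u : 'rV['F_2]_#|X|) :
    u = \row_i (u 0 (enum_rank_in aX (enum_val i))).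
  by apply/rowP=> i; rewrite mxE enum_valK_in.
apply: (@euler_of_exact _ _ _ _ A B).
- apply/card_gt0P; exists (inl x0); rewrite inE; apply/exists_inP.
  by exists (x0, k x0); rewrite ?x0_ED //= eqxx.
- apply/row_matrixP=> i; rewrite row_mul row0.
  have /imsetP[d _ iE] := enum_valP i.
  have -> : row i A = \row_e bnd D (ind (enum_val i)) (enum_val e).
    by apply/rowP=> e; rewrite !mxE.
  have FE : ind (enum_val i) =1 combine (fun F => (F == enum_val i)%:R).
    move=> d'; rewrite /combine (bigD1 (enum_val i)) ?enum_valP //= eqxx mul1r.
    by rewrite big1 ?addr0 // => F /andP[_ /negPf->]; rewrite mul0r.
  rewrite BE => [|d' d'E]; last by rewrite /bnd !FE; apply: bnd_combine.
  by apply/rowP=> v; rewrite !mxE bnd_cycle // iE; apply: ind_mate.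
(* A combination of regions without boundary is constant on the sphere, and it is 0 at infinity. *)
- move=> s0; rewrite (rowP' _ _ _ FR0 s0); set t := fun F => s0 0 (enum_rank_in FR0 F).
  rewrite (AE t) => /rowP t0; apply/rowP=> i; rewrite !mxE -/(t (enum_val i)).
  have tb d : bnd D (combine t) d = 0.
    have [dED|] := boolP (d \in ED); last exact: bnd_combine.
    by have := t0 (enum_rank_in dED d); rewrite !mxE enum_rankK_in.
  have /imsetP[d] := enum_valP i; rewrite inE => hd ->.
  have := sum_regions t d; rewrite hd mul1r -/(combine t d) => <-.
  transitivity (combine t infinity); last by rewrite /combine sum_regions hinf eqxx mul0r.
  apply: (mate_ccw_constant _ _ (combine t)) => [|e]; first exact: combine_mate.
  by apply/esym/F2_eq/tb.
(* A cycle in the disc bounds on the sphere. Normalized to vanish at infinity, the bounding chain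
   vanishes outside [R] and is constant on regions, hence a combination of those in [Reg]. *)
- move=> c0; rewrite (rowP' _ _ _ x0_ED c0).
  pose z d := if d \in ED then c0 0 (enum_rank_in x0_ED d) else 0.
  have -> : \row_(e < #|ED|) c0 0 (enum_rank_in x0_ED (enum_val e)) = \row_e z (enum_val e).
    by apply/matrixP=> i e; rewrite !mxE /z enum_valP.
  have z0 d : d \notin ED -> z d = 0 by rewrite /z => /negPf->.
  rewrite (BE z z0) => /rowP zB.
  have zc : cycle2 D z.
    move=> v; have [vV|vV] := boolP (v \in VD).
      by have := zB (enum_rank_in vV v); rewrite !mxE enum_rankK_in.
    rewrite big1 // => d dv; apply: z0; apply: contra vV => dED.
    by rewrite inE; apply/exists_inP; exists d.
  have n0 : (0 < ncross D)%N by case: (x0) => ? /(leq_trans _); apply.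
  have [h1 hm1 zE] := cycle_bnd D z n0 zc.
  pose h2 d := h1 d + h1 infinity.
  have hm2 : mate_inv D h2 by move=> d; rewrite /h2 hm1.
  have zE2 d : bnd D h2 d = z d by rewrite zE /bnd addrACA addF2 addr0.
  have h2b d : d \notin ED -> bnd D h2 d = 0 by move=> /z0; rewrite zE2.
  have h20 := vanish_outside h2 hm2 (addF2 _) h2b.
  pose t F := h2 (rep F).
  have h2E d : combine t d = h2 d.
    rewrite /combine sum_regions; have [/h20->|hd] := eqVneq (h d) 0; first by rewrite mul0r.
    rewrite mul1r; apply: region_constant (repP d) => // e eC.
    by apply: h2b; rewrite inE (negPf eC).
  exists (\row_i t (enum_val i)); rewrite AE; apply/rowP=> e; rewrite !mxE.
  by rewrite -zE2 /bnd !h2E.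
(* Constants are killed because an edge has two ends; the converse is connectedness of the disc. *)
- move=> gm; split=> [/colP gB|[a ->]]; last first.
    apply/colP=> e; rewrite !mxE.
    transitivity (\sum_(v in VD) (incident D (enum_val e) v)%:R * a).
      by rewrite [RHS]big_enum_val; apply: eq_bigr => v _; rewrite !mxE.
    transitivity (\sum_(v | incident D (enum_val e) v) a); last by rewrite sum_incident addF2.
    rewrite [LHS]big_mkcond [RHS]big_mkcond; apply: eq_bigr => v _ /=.
    case: ifPn => [_|vV]; first by case: ifP; rewrite ?mul1r ?mul0r.
    case: ifP => // ev; move: vV; rewrite inE => /exists_inPn/(_ _ (enum_valP e)).
    by rewrite ev.
  have xV : inl x0 \in VD.
    by rewrite inE; apply/exists_inP; exists (x0, k x0); rewrite ?x0_ED //= eqxx.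
  pose gv v := if v \in VD then gm (enum_rank_in xV v) 0 else 0.
  have gE d : d \in ED -> gv (inl d.1) = gv (inr (face_of d)).
    move=> dED; apply: F2_eq; rewrite -sum_incident.
    have := gB (enum_rank_in dED d); rewrite !mxE => B0; rewrite -[RHS]B0.
    transitivity (\sum_(v in VD) (incident D d v)%:R * gv v).
      rewrite [LHS]big_mkcond [RHS]big_mkcond; apply: eq_bigr => v _ /=.
      by rewrite /gv; case: (v \in VD); case: (incident D d v); rewrite ?mul1r ?mul0r.
    rewrite big_enum_val; apply: eq_bigr => v _.
    by rewrite !mxE enum_rankK_in // /gv enum_valP enum_valK_in.
  exists (gv (inl x0)); apply/colP=> v; rewrite mxE.
  rewrite -(constant_on_disc gv gE (enum_val v)) ?enum_valP //.
  by rewrite /gv enum_valP enum_valK_in.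
Qed.

(** Substituting |R n C| = |ED| - |O| and |Reg| = |ED| + 1 - |VD| with |VD| even leaves |O| + 1
    modulo 2. *)
Lemma alt_cycle_sign :
  \sum_(e in C) edge_sign e * alt_cycle (edge_corner e) = #|O|%:R + 1.
Proof.
rewrite sum_edge_sign -natrD natr1 natF2 [RHS]natF2; congr (nat_of_bool _)%:R.
by have := euler_alt_cycle; have := card_ED; have := card_VD_even; lia.
Qed.

End AlternatingCycle.

(** * Kasteleyn's theorem *)

Section Kasteleyn.
Variables (D : knot_diagram) (f : face D) (g : 'I_(ncross D).+1).
Notation edge := (alexander_edge f (lift f g)).
Variables (infinity : option (corner D)) (eps : edge -> int).
Hypotheses (hinf : is_infinity infinity) (heps : kasteleyn_weighting infinity eps).

(** Extending [eps] by 1 to the corners of the disregarded faces allows sums over all corners. *)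
Definition corner_eps (d : corner D) : int :=
  if insub d is Some e then eps e else 1.

Lemma corner_epsE (e : edge) : corner_eps (edge_corner e) = eps e.
Proof. by rewrite /corner_eps valK. Qed.

Definition corner_sign (d : corner D) : 'F_2 := (corner_eps d == -1)%:R.

Lemma corner_eps_sign d : corner_eps d = (-1) ^+ (corner_eps d == -1).
Proof.
rewrite /corner_eps; case: insub => [e|] //.
by case/orP: (heps.1 e) => /eqP ->.
Qed.

Section TwoMatchings.
Variables (k k' : {ffun crossing D -> 'I_4}) (s s' : {perm crossing D}).
Hypotheses (ks : matching D f g k s) (ks' : matching D f g k' s').
Let pi : {perm crossing D} := (s' * s^-1)%g.

Lemma orbit_corner_sign x :
  \sum_(y in porbit pi x) (corner_sign (y, k y) + corner_sign (y, k' y)) =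
  #|porbit pi x|%:R + 1.
Proof.
have [kk|kx] := eqVneq (k x) (k' x).
  (* If the coverings share the edge at [x], the orbit is [x] alone and both sides are 0. *)
  have pix : pi x = x.
    apply: (@perm_inj _ s); apply: (kept_inj D f g).
    by rewrite -!(matchingE _ _ _ _ _ _ ks) -(switch_face _ _ _ _ _ _ _ ks ks') kk.
  have -> : porbit pi x = [set x].
    apply/setP=> y; rewrite inE; apply/porbitP/eqP => [[i ->]|->]; last first.
      by exists 0%N; rewrite expg0 perm1.
    by elim: i => [|i IH]; rewrite ?expg0 ?perm1 // expgSr permM IH.
  by rewrite big_set1 kk addF2 cards1 addF2.
have n0 : (0 < ncross D)%N by case: (x) => ? /(leq_trans _); apply.
case: infinity hinf heps => [d _|] /=; last by rewrite (gtn_eqF n0).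
move=> hepsd.
have [h0 hm0 h0E] := cycle_bnd _ _ n0 (alt_cycle_cycle2 _ _ _ _ _ _ _ ks ks' x).
(* Adding a constant keeps the boundary and makes the chain vanish at infinity. *)
pose h e := h0 e + h0 d.
have hm : mate_inv D h by move=> e; rewrite /h hm0.
have hE : alt_cycle D k k' s s' x =1 bnd D h.
  by move=> e; rewrite h0E /bnd addrACA addF2 addr0.
rewrite -(alt_cycle_sign _ _ _ _ _ _ _ ks ks' x kx eps d hepsd h hm hE (addF2 _)).
transitivity (\sum_e corner_sign e * alt_cycle D k k' s s' x e).
  by rewrite sum_on_orbit; apply: eq_bigr => y _; rewrite !mulr1.
under [RHS]eq_bigr => e _.
  rewrite /edge_sign -corner_epsE -/(corner_sign (edge_corner e)); over.
rewrite (sum_component _ _ _ _ _ ks x _ (fun e => corner_sign e * alt_cycle D k k' s s' x e)).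
rewrite [RHS]big_mkcond; apply: eq_bigr => e _; case: ifPn => // eC.
suff -> : alt_cycle D k k' s s' x e = 0 by rewrite mulr0.
apply/eqP; apply: contraNT eC; exact: alt_cycle_in_component.
Qed.

(** Over all orbits, [#|X| + 1] adds up to the number of crossings plus the number of orbits, which
    is the parity of [pi]. *)
Lemma kasteleyn_switch :
  \sum_x corner_sign (x, k x) + (odd_perm s)%:R =
  \sum_x corner_sign (x, k' x) + (odd_perm s')%:R.
Proof.
have orbits (F : crossing D -> 'F_2) :
    \sum_x F x = \sum_(X in porbits pi) \sum_(x in X) F x.
  rewrite (partition_big (porbit pi) (mem (porbits pi))) => [|x _]; last exact: imset_f.
  apply: eq_bigr => _ /imsetP[z _ ->]; apply: eq_bigl => x.
  by rewrite /= eq_porbit_mem.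
apply: F2_eq; rewrite addrACA -big_split /= orbits.
have -> : \sum_(X in porbits pi) \sum_(x in X) (corner_sign (x, k x) + corner_sign (x, k' x))
    = \sum_(X in porbits pi) (#|X|%:R + 1).
  by apply: eq_bigr => _ /imsetP[z _ ->]; apply: orbit_corner_sign.
have -> : \sum_(X in porbits pi) (#|X|%:R + 1) = (odd_perm pi)%:R :> 'F_2.
  rewrite big_split /= sumr_const /odd_perm [RHS]natF2 oddb -oddD -natF2 natrD; congr (_ + _).
  rewrite -[in RHS]sum1_card natr_sum orbits; apply: eq_bigr => X _.
  by rewrite sumr_const.
rewrite odd_permM odd_permV addbC.
by case: (odd_perm s); case: (odd_perm s'); apply: val_inj.
Qed.

End TwoMatchings.

(** The numbering changes parity at every quarter turn, so [k x] has the parity of the difference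
    between the north face and the chosen face. A matching chooses every kept face once, so the
    total does not depend on it. *)
Lemma fox_sign (w : 'I_(ncross D).+1 -> int) k s : is_abelianization w ->
  matching D f g k s ->
  \sum_x (k x)%:R = \sum_x (odd `|face_weight D w (face_of (north x))|%N)%:R
    + \sum_j (odd `|face_weight D w (kept D f g j)|%N)%:R :> 'F_2.
Proof.
move=> abw ks; pose W d : 'F_2 := (odd `|face_weight D w (face_of d)|%N)%:R.
have Wx x (j : 'I_4) : W (x, j) = W (x, 0) + (j : nat)%:R.
  have -> : (x, j) = (x, (j : nat)%:R) :> corner D.
    by congr pair; rewrite Zp_nat; apply: val_inj; rewrite /= modn_small.
  elim: (j : nat) => [|i IH]; first by rewrite addr0.
  rewrite mulrSr -natr1 addrA -IH {1}/W.
  rewrite (face_weight_ccw _ _ abw (x, i%:R)) -/(W (x, i%:R)) /W.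
  by case: (odd _); apply: val_inj.
rewrite [X in _ + X](reindex_inj (@perm_inj _ s)) -big_split /=.
apply: eq_bigr => x _; rewrite -(matchingE _ _ _ _ _ _ ks) -/(W (north x)).
by rewrite -/(W (x, k x)) (Wx x (k x)) addrA addF2 add0r.
Qed.

Definition corner_weight (d : corner D) : {poly int} :=
  if (d.2 == 0) || (d.2 == 1) then 'X else 1.

Lemma dimer_sum_det : (exists w, is_abelianization (D := D) w) -> exists b : bool,
  dimer_sum (G := alexander_graph f (lift f g))
    (fun e => (eps e)%:~R * local_weight e) =
  (-1) ^+ b * \det (kept_minor D f g).
Proof.
case=> w abw.
(* The exponent collects the signs of the permutation, of the Fox derivatives and of [eps]. *)
pose sgn (k : {ffun crossing D -> 'I_4}) (s : {perm crossing D}) : nat :=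
  (s + \sum_x k x + \sum_x (corner_eps (x, k x) == -1)%R)%N.
have sgn_const ks ks' : matching D f g ks.1 ks.2 -> matching D f g ks'.1 ks'.2 ->
    odd (sgn ks.1 ks.2) = odd (sgn ks'.1 ks'.2).
  move=> m m'; suff : (sgn ks.1 ks.2)%:R = (sgn ks'.1 ks'.2)%:R :> 'F_2.
    by rewrite natF2 [RHS]natF2; case: (odd _); case: (odd _).
  rewrite /sgn !natrD !natr_sum (fox_sign w _ _ abw m) (fox_sign w _ _ abw m').
  have := kasteleyn_switch _ _ _ _ m m'; rewrite /corner_sign => E.
  by rewrite addrAC [X in X + _]addrC E [in RHS]addrAC [in RHS](addrC (nat_of_bool _)%:R).
have [b bP] : exists b, forall ks, matching D f g ks.1 ks.2 -> odd (sgn ks.1 ks.2) = b.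
  have [ks0 m0|nomatch] := pickP (fun ks => matching D f g ks.1 ks.2).
    by exists (odd (sgn ks0.1 ks0.2)) => ks m; apply: sgn_const.
  (* Without matchings both sums are empty and any sign will do. *)
  by exists false => ks; rewrite nomatch.
exists b; rewrite det_kept_minor.
transitivity (dimer_sum (G := alexander_graph f (lift f g))
   (fun e => (corner_eps (edge_corner e))%:~R * corner_weight (edge_corner e))).
  apply: eq_bigr => m _; apply: eq_bigr => e _; by rewrite corner_epsE.
rewrite (dimer_sumE _ _ _ _ (fun d => (corner_eps d)%:~R * corner_weight d)) mulr_sumr.
apply: eq_bigr => ks m; rewrite -(bP ks m) signr_odd /sgn !exprD.
set a := (-1) ^+ ks.2; set p := _ ^+ _; set q := _ ^+ _.
have -> : a * p * q * (a * \prod_x fox_weight (ks.1 x)) =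
    (a * a) * (p * q * \prod_x fox_weight (ks.1 x)) by ring.
rewrite -expr2 sqrr_sign mul1r /p /q -!prodrXr -!big_split /=.
apply: eq_bigr => x _; rewrite /fox_weight /corner_weight /=.
rewrite [RHS]mulrACA -expr2 sqrr_sign mul1r.
by rewrite [X in X%:~R]corner_eps_sign rmorphXn rmorphN rmorph1.
Qed.
End Kasteleyn.

Theorem proposition3p4 (D : knot_diagram) (f1 f2 : face D)
    (hadj : adjacent f1 f2)
    (infinity : option (corner D)) (hinf : is_infinity infinity)
    (eps : alexander_edge f1 f2 -> int)
    (heps : kasteleyn_weighting infinity eps)
    (Delta : laurent) (hDelta : is_alexander_polynomial D Delta) :
  doteq Delta
    (tofrac (dimer_sum (G := alexander_graph f1 f2)
       (fun e => (eps e)%:~R * local_weight e))).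
Proof.
have [g f2E] : exists g, f2 = lift f1 g.
  have := adjacent_neq D f1 f2 Delta hDelta hadj.
  by case: (unliftP f1 f2) => [g -> _|->]; [exists g | rewrite eqxx].
subst f2; apply: doteq_trans (alexander_kept_minor D f1 g Delta hDelta hadj) _.
have [w [_ [abw _ _]]] := hDelta.
have [b ->] := dimer_sum_det D f1 g infinity eps hinf heps (ex_intro _ w abw).
apply: doteq_sym; apply: (doteq_sign b).
by rewrite rmorphM rmorphXn rmorphN rmorph1.
Qed.
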